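(* Let $\widetilde R_q(z)$ be the normalized one-parameter affine $R$-matrix of type $B_n$, $C_n$ or $D_n$, and let $L_\delta,L_{\varepsilon_1},\dots,L_{\varepsilon_n}$ be algebraically independent transcendental elements. There is a unique injective algebra homomorphism $$\widehat\eta_R\colon\widetilde U(\widetilde R_q(z))\to\widetilde U'(\widetilde R_q(z))\otimes\mathbb K[L_\delta^{\pm1},L_{\varepsilon_1}^{\pm1},\dots,L_{\varepsilon_n}^{\pm1}]$$ given by $$\widehat\eta_R(\gamma^{1/2})=\gamma^{1/2}\otimes L_{-\delta},\qquad\widehat\eta_R((\gamma')^{1/2})=\gamma^{-1/2}\otimes L_{-\delta},$$ $$\widehat\eta_R(\ell_{ij}^\pm[\mp m])=\ell_{ij}^\pm[\mp m]\otimes L_{-\varepsilon_i-\varepsilon_j-2m\delta}\qquad\text{for all }1\le i,j\le N,\ m\in\mathbb Z_{\ge0},$$ where $L_\mu=L_\delta^{c_0}L_{\varepsilon_1}^{c_1}\cdots L_{\varepsilon_n}^{c_n}$ for $\mu=c_0\delta+\sum_{i=1}^nc_i\varepsilon_i$ with $c_i\in\mathbb Z$.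
   Context: $\mathbb K$ is an algebraically closed field, $q\in\mathbb K$ is transcendental (in particular not a root of unity). Type $B_n$: $N=2n+1$, $i'=2n+2-i$, $v=q^{-2}$, $\xi=q^{-4n+2}$. Type $C_n$: $N=2n$, $i'=2n+1-i$, $v=q^{-1}$, $\xi=q^{-2-2n}$. Type $D_n$ ($n\ge3$): $N=2n$, $i'=2n+1-i$, $v=q^{-1}$, $\xi=q^{2-2n}$. $\varepsilon_1,\dots,\varepsilon_n$ are the standard weights, $\varepsilon_{i'}=-\varepsilon_i$ for $i\le n$, and $\varepsilon_{n+1}=0$ in type $B_n$; $\delta$ is a formal symbol independent of them. $E_{ij}$ are matrix units, $\tau$ the flip on $\mathbb K^N\otimes\mathbb K^N$. Unless indicated, indices run over $1,\dots,N$. Finite matrices: type $B_n$: $\hat R_q=q^{-2}\sum_{i\ne n+1}E_{ii}\otimes E_{ii}+E_{n+1,n+1}\otimes E_{n+1,n+1}+q^2\sum_{i\ne n+1}E_{ii'}\otimes E_{i'i}+\sum_{j\ne i,i'}E_{ij}\otimes E_{ji}+(q^2-q^{-2})\sum_{i=1}^n(q^{4(n-i)+2}-1)E_{i'i'}\otimes E_{ii}+(q^{-2}-q^2)\sum_{i>j,\,j\ne i'}E_{ii}\otimes E_{jj}+(q^2-q^{-2})\sum_{i<j,\,j\ne i'}t_it_j^{-1}E_{i'j}\otimes E_{ij'}$, $t_i=q^{2(n-i)+1}$ for $i\le n$, $t_{n+1}=q$, $t_i=q^{2(n+1-i)+1}$ for $i>n+1$. Type $C_n$: $\hat R_q=q^{-1}\sum_iE_{ii}\otimes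 E_{ii}+q\sum_iE_{ii'}\otimes E_{i'i}+\sum_{j\ne i,i'}E_{ij}\otimes E_{ji}+(q^{-1}-q)\sum_{i=1}^n(q^{2(n+1-i)}+1)E_{i'i'}\otimes E_{ii}+(q^{-1}-q)\sum_{i>j,\,j\ne i'}E_{ii}\otimes E_{jj}+(q-q^{-1})\sum_{i<j,\,j\ne i'}t_it_j^{-1}E_{i'j}\otimes E_{ij'}$, $t_i=q^{n+1-i}$ for $i\le n$, $t_i=-q^{n-i}$ for $i>n$. Type $D_n$: the same expression as for $C_n$ but with $(q^{-1}-q)\sum_{i=1}^n(1-q^{2(n-i)})E_{i'i'}\otimes E_{ii}$ as the fourth term and $t_i=q^{n-i}$ for $i\le n$, $t_i=q^{n+1-i}$ for $i>n$. Affine matrix: $\hat R_q(z)=vz(z-1)\hat R_q^{-1}+(1-\xi)(1-v^2)z\,\mathrm{Id}-\xi v(z-1)\hat R_q$, $R_q(z)=\hat R_q(z)\circ\tau$, $\widetilde R_q(z)=f(z)R_q(z)$, where $f(z)=\prod_{k\ge0}\frac{(1-z\xi^{2k})(1-zv^2\xi^{2k+1})(1-zv^{-2}\xi^{2k+1})(1-z\xi^{2k+2})}{(1-z\xi^{2k-1})(1-z\xi^{2k+1})(1-zv^{-2}\xi^{2k})(1-zv^2\xi^{2k})}$ as a formal power series in $z$, i.e. the unique series with $f(0)=1$ and $f(z)f(z\xi)=\frac1{(1-zv^2)(1-zv^{-2})(1-z\xi)(1-z\xi^{-1})}$. $U(R(z))$ is the $\mathbb K$-algebra generated by central invertible $\gamma^{\pm1/2},(\gamma')^{\pm1/2}$,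 by $\ell_{ij}^\pm[\mp m]$ ($1\le i,j\le N$, $m\ge0$) and $(\ell_{ii}^\pm[0])^{-1}$, with $\ell_{ij}^+[0]=\ell_{ji}^-[0]=0$ for $i<j$, $\ell_{ii}^\pm[0](\ell_{ii}^\pm[0])^{-1}=(\ell_{ii}^\pm[0])^{-1}\ell_{ii}^\pm[0]=1$, $R(z/w)L_1^\pm(z)L_2^\pm(w)=L_2^\pm(w)L_1^\pm(z)R(z/w)$, $R(z\gamma(\gamma\gamma')^{1/2}/w)L_1^+(z)L_2^-(w)=L_2^-(w)L_1^+(z)R(z\gamma'(\gamma\gamma')^{1/2}/w)$, where $R$ is expanded as a power series in its argument, $\ell_{ij}^\pm(w)=\sum_{m\ge0}\ell_{ij}^\pm[\mp m]w^{\pm m}$, $L_1^\pm(w)=\sum E_{ij}\otimes1\otimes\ell_{ij}^\pm(w)$, $L_2^\pm(w)=\sum1\otimes E_{ij}\otimes\ell_{ij}^\pm(w)$. Put $A^{\mathsf t'}=(a_{j'i'})$ for $A=(a_{ij})$. $C_q=\mathrm{diag}(c_i)$: type $B_n$: $c_i=q^{2\rho_i}$, $(\rho_i)=(n-\frac12,\dots,\frac12,\frac12,-\frac12,\dots,-n+\frac12)$; type $C_n$: $c_i=\sigma_iq^{\rho_i}$, $(\rho_i)=(n,\dots,1,-1,\dots,-n)$, $\sigma_i=1$ for $i\le n$, $-1$ for $i>n$; type $D_n$: $c_i=q^{\rho_i}$, $(\rho_i)=(n-1,\dots,1,0,0,-1,\dots,-n+1)$. $\widetilde U(\widetilde R_q(z))$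 is the quotient of $U(\widetilde R_q(z))$ by $L^\pm(z)C_qL^\pm(z\xi)^{\mathsf t'}C_q^{-1}=I$ and, in type $B_n$, by $\ell_{n+1,n+1}^\pm[0]=1$. $\widetilde U'(\widetilde R_q(z))$ is the quotient of $\widetilde U(\widetilde R_q(z))$ by the further relations $(\gamma')^{1/2}=\gamma^{-1/2}$ and $(\ell_{ii}^\pm[0])^{-1}=\ell_{ii}^\mp[0]$ for $1\le i\le N$. *)

(* Defs.v *)
From HB Require Import structures.
From mathcomp Require Import all_boot all_order all_algebra.
From mathcomp Require Import generic_quotient boolp.
From mathcomp Require Import finmap mxtens zify.
From mathcomp.multinomials Require Import monalg.
Set Implicit Arguments.
Unset Strict Implicit.
Unset Printing Implicit Defensive.
Import GRing.Theory.
Local Open Scope ring_scope.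
Local Open Scope quotient_scope.

(* A unital associative K-algebra, possibly zero, as a ring A with a central
   ring homomorphism scal : K -> A, so that k *: x is scal k * x. The library's
   algType is not used because it requires 1 != 0, which is not known a priori
   for an algebra given by generators and relations. *)
HB.mixin Record isPzAlgebra (K : pzRingType) A of GRing.PzRing A := {
  scal : K -> A;
  scal_zmod : zmod_morphism scal;
  scal_monoid : monoid_morphism scal;
  scal_central : forall (k : K) (x : A), scal k * x = x * scal k
}.
#[short(type="pzAlgType")]
HB.structure Definition PzAlgebra (K : pzRingType) :=
  {A of isPzAlgebra K A & GRing.PzRing A}.

Definition is_alg_hom (K : pzRingType) (A B : pzAlgType K) (f : A -> B) : Prop :=
  [/\ zmod_morphism f, monoid_morphism f & forall k, f (scal k) = scal k].

(* Noncommutative polynomials: {fmonom X} is the monoid of words over X. *)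
Definition free_alg (K : fieldType) (X : choiceType) : Type :=
  {malg K[{fmonom X}]}.

Section FreeAlg.
Variables (K : fieldType) (X : choiceType).
HB.instance Definition _ := GRing.Lalgebra.on (free_alg K X).

Definition fgen (x : X) : free_alg K X := mkmalgU (fmu x) 1.

Let freeC (k : K) : free_alg K X := k%:MP.

Fact freeC_zmod : zmod_morphism freeC.
Proof. exact: raddfB. Qed.

Fact freeC_monoid : monoid_morphism freeC.
Proof. by split; [exact: rmorph1 | exact: rmorphM]. Qed.

Fact freeC_central (k : K) (x : free_alg K X) : freeC k * x = x * freeC k.
Proof.
rewrite /freeC !malgM_def fgmulUg fgmulgU; apply: eq_bigr => m _.
by rewrite mul1m mulm1 mulrC.
Qed.

HB.instance Definition _ :=
  isPzAlgebra.Build K (free_alg K X) freeC_zmod freeC_monoid freeC_central.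

Lemma free_ind (P : free_alg K X -> Prop) :
  (forall x y, P x -> P y -> P (x + y)) -> (forall k, P (scal k)) ->
  (forall x a, P a -> P (fgen x * a)) -> (forall k a, P a -> P (scal k * a)) ->
  forall a, P a.
Proof.
move=> PD PC PM PZ a.
rewrite [a]monalgE; elim/big_ind: _ => //.
  by rewrite -(raddf0 freeC); apply: PC.
move=> m _.
have -> : << a@_m *g m >> = scal a@_m * (<< 1 *g m >> : free_alg K X).
  by rewrite /scal /= /freeC malgM_def fgmulUU mul1m mulr1.
apply: PZ; case: m => s; elim: s => [|x s IHs].
  have -> : << 1 *g FMonom [::] >> = scal 1 :> free_alg K X; last exact: PC.
  by rewrite -fmoneE.
have -> : << 1 *g FMonom (x :: s) >> =
   fgen x * (<< 1 *g FMonom s >> : free_alg K X); last exact: PM.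
rewrite malgM_def fgmulUU mulr1; congr << _ *g _ >>.
by apply/eqP; rewrite fmP /mmul /mul /= fmmulE fmuE.
Qed.

Lemma free_hom_unique (A : pzAlgType K) (f g : free_alg K X -> A) :
  is_alg_hom f -> is_alg_hom g -> (forall x, f (fgen x) = g (fgen x)) -> f =1 g.
Proof.
move=> [fB [f1 fM] fC] [gB [g1 gM] gC] fg.
have D (h : free_alg K X -> A) x y : zmod_morphism h -> h (x + y) = h x + h y.
  move=> hB; have h0 : h 0 = 0 by rewrite -[0](subrr 0) hB subrr.
  by rewrite -{1}[y]opprK hB -[- y]sub0r hB h0 sub0r opprK.
apply: free_ind.
- by move=> x y ex ey; rewrite !D // ex ey.
- by move=> k; rewrite fC gC.
- by move=> x a ea; rewrite fM gM fg ea.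
- by move=> k a ea; rewrite fM gM fC gC ea.
Qed.

Lemma free_hom_exists (A : pzAlgType K) (u : X -> A) :
  exists2 f : free_alg K X -> A, is_alg_hom f & forall x, f (fgen x) = u x.
Proof.
have AB := @scal_zmod K A.
have AC0 : scal 0 = 0 :> A by rewrite -[0](subrr 0) AB subrr.
have ACD (k l : K) : scal (k + l) = scal k + scal l :> A.
  by rewrite -{1}[l]opprK AB -[- l]sub0r AB AC0 sub0r opprK.
have [AC1 ACM] := @scal_monoid K A.
pose h (m : fmonom X) := \prod_(x <- (m : seq X)) u x.
pose f (a : free_alg K X) := \sum_(m <- msupp a) scal a@_m * h m.
have fE (d : {fset _}) a :
    (msupp a `<=` d)%fset -> f a = \sum_(m <- d) scal a@_m * h m.
  move=> le; rewrite /f (big_fset_incl _ le) => //= m _ /mcoeff_outdom ->.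
  by rewrite AC0 mul0r.
have fU k m : f << k *g m >> = scal k * h m.
  by rewrite (fE _ _ msuppU_le) big_seq_fset1 mcoeffUU.
have fD x y : f (x + y) = f x + f y.
  pose E := (msupp x `|` msupp y)%fset.
  have sx : (msupp x `<=` E)%fset by apply: fsubsetUl.
  have sy : (msupp y `<=` E)%fset by apply: fsubsetUr.
  have sxy : (msupp (x + y) `<=` E)%fset by apply: msuppD_le.
  rewrite !(fE E) // -big_split /=; apply: eq_bigr => m _.
  by rewrite mcoeffD ACD mulrDl.
have f0 : f 0 = 0 by apply: (addrI (f 0)); rewrite -fD !addr0.
have fB : zmod_morphism f.
  by move=> x y; apply: (addIr (f y)); rewrite -fD !subrK.
have h1 : h mone = 1 by rewrite /h /mone /one /= fmoneE big_nil.
have hM m l : h (mmul m l) = h m * h l.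
  by rewrite /h /mmul /mul /= fmmulE big_cat.
have fC k : f (scal k) = scal k by rewrite fU h1 mulr1.
have f1 : f 1 = 1 by rewrite -AC1 -fC.
have auxC k b : f (scal k * b) = scal k * f b.
  rewrite malgM_def fgmulUg (big_morph f fD f0) [in RHS]/f mulr_sumr.
  by apply: eq_bigr => m _; rewrite fU mul1m ACM mulrA.
have auxG x b : f (fgen x * b) = u x * f b.
  rewrite malgM_def fgmulUg (big_morph f fD f0) [in RHS]/f mulr_sumr.
  apply: eq_bigr => m _; rewrite mul1r fU hM !mulrA scal_central; congr (_ * _ * _).
  by rewrite /h fmuE big_seq1.
exists f; last by move=> x; rewrite fU AC1 mul1r /h fmuE big_seq1.
split=> //; split=> // x y; move: x; apply: free_ind.
- by move=> a b ea eb; rewrite mulrDl !fD ea eb mulrDl.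
- by move=> k; rewrite auxC fC.
- by move=> x a ea; rewrite -mulrA !auxG ea mulrA.
- by move=> k a ea; rewrite -mulrA !auxC ea mulrA.
Qed.

End FreeAlg.

Section QuotAlg.
Variables (K : fieldType) (A : pzAlgType K) (rel : A -> A -> Prop).

Inductive gen_ideal : A -> Prop :=
| gi_rel x y : rel x y -> gen_ideal (x - y)
| gi_0 : gen_ideal 0
| gi_add x y : gen_ideal x -> gen_ideal y -> gen_ideal (x + y)
| gi_mull a x : gen_ideal x -> gen_ideal (a * x)
| gi_mulr a x : gen_ideal x -> gen_ideal (x * a).

Fact gi_opp x : gen_ideal x -> gen_ideal (- x).
Proof. by move=> Ix; rewrite -mulN1r; apply: gi_mull. Qed.

Definition quot_rel (x y : A) : bool := `[< gen_ideal (x - y) >].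

Fact quot_rel_equiv : equiv_class_of quot_rel.
Proof.
split.
- by move=> x; apply/asboolP; rewrite subrr; apply: gi_0.
- by move=> x y; apply/asboolP/asboolP => /gi_opp; rewrite opprB.
- move=> y x z /asboolP Ixy /asboolP Iyz; apply/asboolP.
  by rewrite -[x](subrK y) -addrA; apply: gi_add.
Qed.

Canonical quot_rel_equivRel := EquivRelPack quot_rel_equiv.
Canonical quot_rel_encModRel := defaultEncModRel quot_rel.

(* The quotient of A by the two-sided ideal generated by all x - y, rel x y. *)
Definition quot_alg := {eq_quot quot_rel}.
HB.instance Definition _ := Choice.on quot_alg.
HB.instance Definition _ := EqQuotient.on quot_alg.

Definition qpi (x : A) : quot_alg := \pi_quot_alg x.

Lemma qpi_eq x y : qpi x = qpi y <-> gen_ideal (x - y).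
Proof.
by split => [/eqP|I]; [rewrite piE => /asboolP | apply/eqP; rewrite piE; apply/asboolP].
Qed.

Lemma qpi_surj a : exists x, a = qpi x.
Proof. by exists (repr a); rewrite /qpi reprK. Qed.

Lemma qpi_rel x y : rel x y -> qpi x = qpi y.
Proof. by move=> ?; apply/qpi_eq/gi_rel. Qed.

Definition quot_add (a b : quot_alg) := qpi (repr a + repr b).
Definition quot_opp (a : quot_alg) := qpi (- repr a).
Definition quot_mul (a b : quot_alg) := qpi (repr a * repr b).

Fact gi_repr x : gen_ideal (repr (qpi x) - x).
Proof. by apply/qpi_eq; rewrite /qpi reprK. Qed.

Fact quot_addE x y : quot_add (qpi x) (qpi y) = qpi (x + y).
Proof. by apply/qpi_eq; rewrite opprD addrACA; apply: gi_add; apply: gi_repr. Qed.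

Fact quot_oppE x : quot_opp (qpi x) = qpi (- x).
Proof. by apply/qpi_eq; rewrite -opprD; apply: gi_opp; apply: gi_repr. Qed.

Fact quot_mulE x y : quot_mul (qpi x) (qpi y) = qpi (x * y).
Proof.
apply/qpi_eq; set x' := repr _; set y' := repr _.
have -> : x' * y' - x * y = (x' - x) * y' + x * (y' - y).
  by rewrite mulrBl mulrBr addrA subrK.
by apply: gi_add; [apply: gi_mulr | apply: gi_mull]; apply: gi_repr.
Qed.

Let qE := (quot_addE, quot_oppE, quot_mulE).
Local Ltac reps := repeat (let a := fresh in let x := fresh in
  intro a; case: (qpi_surj a) => x ->).

Fact quot_addA : associative quot_add.
Proof. by reps; rewrite !qE addrA. Qed.
Fact quot_addC : commutative quot_add.
Proof. by reps; rewrite !qE addrC. Qed.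
Fact quot_add0 : left_id (qpi 0) quot_add.
Proof. by reps; rewrite !qE add0r. Qed.
Fact quot_addN : left_inverse (qpi 0) quot_opp quot_add.
Proof. by reps; rewrite !qE addNr. Qed.
HB.instance Definition _ := GRing.isZmodule.Build quot_alg
  quot_addA quot_addC quot_add0 quot_addN.

Fact quot_mulA : associative quot_mul.
Proof. by reps; rewrite !qE mulrA. Qed.
Fact quot_mul1 : left_id (qpi 1) quot_mul.
Proof. by reps; rewrite !qE mul1r. Qed.
Fact quot_1mul : right_id (qpi 1) quot_mul.
Proof. by reps; rewrite !qE mulr1. Qed.
Fact quot_mulDl : left_distributive quot_mul quot_add.
Proof. by reps; rewrite !qE mulrDl. Qed.
Fact quot_mulDr : right_distributive quot_mul quot_add.
Proof. by reps; rewrite !qE mulrDr. Qed.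
HB.instance Definition _ := GRing.Zmodule_isPzRing.Build quot_alg
  quot_mulA quot_mul1 quot_1mul quot_mulDl quot_mulDr.

Let quotC (k : K) : quot_alg := qpi (scal k).

Fact quotC_zmod : zmod_morphism quotC.
Proof. by move=> k l; rewrite /quotC scal_zmod -quot_addE -quot_oppE. Qed.

Fact quotC_monoid : monoid_morphism quotC.
Proof.
have [A1 AM] := @scal_monoid K A.
by split=> [|k l]; rewrite /quotC ?A1 // AM -quot_mulE.
Qed.

Fact quotC_central k (a : quot_alg) : quotC k * a = a * quotC k.
Proof. by move: a; reps; rewrite /GRing.mul /= !qE scal_central. Qed.

HB.instance Definition _ :=
  isPzAlgebra.Build K quot_alg quotC_zmod quotC_monoid quotC_central.

Lemma qpi_hom : is_alg_hom qpi.
Proof.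
split=> [x y||//]; first by rewrite -quot_addE -quot_oppE.
by split=> // x y; rewrite -quot_mulE.
Qed.

Lemma quot_hom_exists (B : pzAlgType K) (f : A -> B) :
  is_alg_hom f -> (forall x y, rel x y -> f x = f y) ->
  exists2 g : quot_alg -> B, is_alg_hom g & forall x, g (qpi x) = f x.
Proof.
move=> [fB [f1 fM] fC] frel.
have f0 : f 0 = 0 by rewrite -[0](subrr 0) fB subrr.
have fI x : gen_ideal x -> f x = 0.
  elim=> {x}//.
  - by move=> x y /frel fxy; rewrite fB fxy subrr.
  - move=> x y _ fx _ fy.
    by rewrite -[y]opprK fB -[- y]sub0r fB f0 fx fy !subrr.
  - by move=> a x _ fx; rewrite fM fx mulr0.
  - by move=> a x _ fx; rewrite fM fx mul0r.
have gE x : f (repr (qpi x)) = f x.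
  by apply/eqP; rewrite -subr_eq0 -fB fI //; apply: gi_repr.
have [pB [p1 pM] pC] := qpi_hom.
exists (fun a => f (repr a)) => //; split.
- by reps; rewrite -pB !gE fB.
- by split; [rewrite -p1 gE | reps; rewrite -pM !gE fM].
- by move=> k; rewrite -pC gE fC.
Qed.

Lemma quot_hom_unique (B : pzAlgType K) (f g : quot_alg -> B) :
  (forall x, f (qpi x) = g (qpi x)) -> f =1 g.
Proof. by move=> fg; reps. Qed.

End QuotAlg.

Section Tensor.
Variables (K : fieldType) (A B : pzAlgType K).

Local Notation inA a := (@fgen K (A + B)%type (inl a)).
Local Notation inB b := (@fgen K (A + B)%type (inr b)).

Variant tensor_rel : free_alg K (A + B)%type -> free_alg K (A + B)%type -> Prop :=
| tl_add a a' : tensor_rel (inA (a + a')) (inA a + inA a')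
| tl_mul a a' : tensor_rel (inA (a * a')) (inA a * inA a')
| tl_scal k : tensor_rel (inA (scal k)) (scal k)
| tr_add b b' : tensor_rel (inB (b + b')) (inB b + inB b')
| tr_mul b b' : tensor_rel (inB (b * b')) (inB b * inB b')
| tr_scal k : tensor_rel (inB (scal k)) (scal k)
| t_comm a b : tensor_rel (inA a * inB b) (inB b * inA a).

(* The tensor product of the algebras A and B over K, i.e. the universal algebra
   that receives A and B with commuting images (tens_hom_exists and
   tens_hom_unique below). *)
Definition tensor : pzAlgType K := quot_alg tensor_rel.
Definition tens (a : A) (b : B) : tensor := qpi tensor_rel (inA a * inB b).

Lemma tens_hom_unique (C : pzAlgType K) (h h' : tensor -> C) :
  is_alg_hom h -> is_alg_hom h' ->
  (forall a b, h (tens a b) = h' (tens a b)) -> h =1 h'.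
Proof.
have [pB [p1 pM] pC] := qpi_hom tensor_rel.
have inA1 : qpi tensor_rel (inA 1) = 1.
  have [A1 _] := @scal_monoid K A; rewrite -p1.
  have [F1 _] := @scal_monoid K (free_alg K (A + B)%type).
  by rewrite -A1 -F1; apply/qpi_rel/tl_scal.
have inB1 : qpi tensor_rel (inB 1) = 1.
  have [A1 _] := @scal_monoid K B; rewrite -p1.
  have [F1 _] := @scal_monoid K (free_alg K (A + B)%type).
  by rewrite -A1 -F1; apply/qpi_rel/tr_scal.
have compp (g : tensor -> C) : is_alg_hom g -> is_alg_hom (g \o qpi tensor_rel).
  move=> [gB [g1 gM] gC]; split=> [x y|| k] /=; rewrite ?pB ?gB ?pC ?gC //.
  by split=> [|x y] /=; rewrite ?p1 ?g1 ?pM ?gM.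
move=> hh hh' E; apply: quot_hom_unique.
apply: (free_hom_unique (compp _ hh) (compp _ hh')) => -[a|b] /=.
  by have := E a 1; rewrite /tens pM inB1 mulr1.
by have := E 1 b; rewrite /tens pM inA1 mul1r.
Qed.

Lemma tens_hom_exists (C : pzAlgType K) (f : A -> C) (g : B -> C) :
  is_alg_hom f -> is_alg_hom g -> (forall a b, f a * g b = g b * f a) ->
  exists2 h : tensor -> C, is_alg_hom h & forall a b, h (tens a b) = f a * g b.
Proof.
move=> [fB [f1 fM] fC] [gB [g1 gM] gC] fg.
pose u (x : A + B) := match x with inl a => f a | inr b => g b end.
have [F hF Fu] := free_hom_exists u; have [FB [F1 FM] FC] := hF.
have morphD (X Y : zmodType) (e : X -> Y) :
    zmod_morphism e -> {morph e : x y / x + y}.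
  move=> eB; have e0 : e 0 = 0 by rewrite -[0](subrr 0) eB subrr.
  by move=> x y; rewrite -{1}[y]opprK eB -[- y]sub0r eB e0 sub0r opprK.
have [x y r|h hh hE] := quot_hom_exists (rel := tensor_rel) hF.
  case: r => *; rewrite ?(morphD _ _ _ FB) ?FM ?Fu ?FC //=.
  - exact: (morphD _ _ _ fB).
  - exact: (morphD _ _ _ gB).
by exists h => // a b; rewrite /tens hE FM !Fu.
Qed.
End Tensor.

Section Laurent.
Variables (K : fieldType) (m : nat).

Local Notation gen := (@fgen K ('I_m * bool)%type).

(* The generator (i, true) stands for L_i and (i, false) for its inverse. *)
Variant laurent_rel : free_alg K ('I_m * bool)%type ->
                      free_alg K ('I_m * bool)%type -> Prop :=
| laurent_comm x y : laurent_rel (gen x * gen y) (gen y * gen x)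
| laurent_inv i : laurent_rel (gen (i, true) * gen (i, false)) 1.

(* K[L_i, L_i^-1 | i < m], the Laurent polynomials in m independent variables. *)
Definition laurent : pzAlgType K := quot_alg laurent_rel.

Definition lvar (i : 'I_m) (s : bool) : laurent := qpi laurent_rel (gen (i, s)).

(* \prod_i L_i ^ mu_i *)
Definition lmonom (mu : 'rV[int]_m) : laurent :=
  \prod_(i < m) lvar i (0 <= mu ord0 i) ^+ `|mu ord0 i|%N.
End Laurent.

Section PowerSeries.
Variable K : fieldType.

(* A formal power series is the sequence of its coefficients. *)
Definition ps_mul (f g : nat -> K) : nat -> K :=
  fun m => \sum_(k < m.+1) f k * g (m - k)%N.
Definition ps_of_poly (p : {poly K}) : nat -> K := fun m => p`_m.
Definition ps_dilate (a : K) (f : nat -> K) : nat -> K := fun m => a ^+ m * f m.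

(* f(0) = 1 and f(z) f(z xi) = 1 / ((1 - z v^2) (1 - z v^-2) (1 - z xi) (1 - z xi^-1)) *)
Definition normalizing_series (xi v : K) (f : nat -> K) : Prop :=
  f 0%N = 1 /\
  ps_mul (ps_mul f (ps_dilate xi f))
    (ps_of_poly ((1 - (v ^+ 2) *: 'X) * (1 - (v ^- 2) *: 'X)
                 * (1 - xi *: 'X) * (1 - xi^-1 *: 'X)))
  =1 ps_of_poly 1.

Lemma triangular_series (c : nat -> K) (Phi : nat -> (nat -> K) -> K) :
  (forall m, c m != 0) ->
  (forall m f g, (forall k, (k < m)%N -> f k = g k) -> Phi m f = Phi m g) ->
  exists2 f : nat -> K, (forall m, c m * f m + Phi m f = 0) &
    forall g, (forall m, c m * g m + Phi m g = 0) -> g =1 f.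
Proof.
move=> c0 PhiE.
pose fix s (m : nat) : seq K := if m is k.+1
  then rcons (s k) (- Phi k (nth 0 (s k)) / c k) else [::].
have sz m : size (s m) = m by elim: m => //= m IHm; rewrite size_rcons IHm.
have sE m k l : (k < m)%N -> (m <= l)%N -> nth 0 (s l) k = nth 0 (s m) k.
  move=> km; elim: l => [|l IHl]; first by case: m km.
  rewrite leq_eqVlt => /predU1P[->//|]; rewrite ltnS => ml /=.
  by rewrite nth_rcons sz (leq_trans km ml) IHl.
pose f m := nth 0 (s m.+1) m.
have fE m : f m = - Phi m f / c m.
  rewrite /f /= nth_rcons sz ltnn eqxx; congr (- _ / _); apply: PhiE => k km.
  exact: (sE k.+1).
exists f => [m|g gE m]; first by rewrite {1}fE mulrC divfK ?addNr.
elim/ltn_ind: m => m IHm; apply: (mulfI (c0 m)).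
have -> : c m * f m = - Phi m f by rewrite fE mulrC divfK.
rewrite -(PhiE _ _ _ IHm); apply/eqP; rewrite -addr_eq0; exact/eqP/gE.
Qed.

Lemma normalizing_series_exists (xi v : K) :
  (forall k, (0 < k)%N -> 1 + xi ^+ k != 0) ->
  exists2 f, normalizing_series xi v f &
    forall g, normalizing_series xi v g -> g =1 f.
Proof.
move=> xi1; rewrite /normalizing_series; set p := (X in ps_of_poly X).
have p0 : p`_0 = 1 by rewrite -horner_coef0 !hornerE !(mulr0, subr0, mul1r).
pose E (f : nat -> K) := ps_mul (ps_mul f (ps_dilate xi f)) (ps_of_poly p).
pose tr (m : nat) (f : nat -> K) k := if (k < m)%N then f k else 0.
pose c (m : nat) := if m is 0 then 1 else 1 + xi ^+ m.
pose Phi (m : nat) (f : nat -> K) := if m is 0 then - 1 else E (tr m f) m.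
have EE f m : f 0%N = 1 -> (0 < m)%N -> E f m = c m * f m + Phi m f.
  pose G (h : nat -> K) := ps_mul h (ps_dilate xi h).
  move=> f0 m0; have trl k : (k < m)%N -> tr m f k = f k by rewrite /tr => ->.
  have GE k : (k < m)%N -> G (tr m f) k = G f k.
    move=> km; apply: eq_bigr => j _; rewrite /ps_dilate !trl //.
      exact: leq_ltn_trans (leq_subr _ _) km.
    by apply: leq_ltn_trans km; rewrite -ltnS.
  have Gm : G f m = c m * f m + G (tr m f) m.
    case: m m0 trl {GE} => // m _ trl; rewrite /G /ps_mul /ps_dilate.
    rewrite big_ord_recl big_ord_recr /=.
    rewrite [X in _ = _ + X]big_ord_recl [X in _ = _ + (_ + X)]big_ord_recr /=.
    rewrite !subn0 /bump /= !add1n !subnn.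
    have -> : tr m.+1 f m.+1 = 0 by rewrite /tr ltnn.
    rewrite f0 !(mulr0, mul0r, add0r, addr0, mul1r, mulr1, expr0).
    rewrite mulrDl mul1r [X in _ + X = _]addrC addrA; congr (_ + _).
      by rewrite addrC.
    apply: eq_bigr => j _.
    have j1 : (1 + j < m.+1)%N by rewrite add1n ltnS.
    have j2 : (m.+1 - (1 + j) < m.+1)%N by rewrite add1n subSS ltnS leq_subr.
    by rewrite !trl.
  rewrite /E; have -> : Phi m f = E (tr m f) m by case: (m) m0.
  rewrite /E {1 3}/ps_mul !big_ord_recr /= subnn /ps_of_poly p0 !mulr1.
  rewrite -!/(G _) Gm addrCA; congr (_ + _); congr (_ + _).
  by apply: eq_bigr => k _; rewrite GE.
have c0 m : c m != 0 by case: m => [|m] /=; rewrite ?oner_eq0 ?xi1.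
have PhiE m g h : (forall k, (k < m)%N -> g k = h k) -> Phi m g = Phi m h.
  case: m => // m gh; rewrite /Phi; congr (E _ m.+1); apply/funext => k.
  by rewrite /tr; case: ifP => // /gh.
have E0 f : f 0%N = 1 -> E f 0%N = 1.
  move=> f0; rewrite /E /ps_mul !big_ord_recl !big_ord0 !addr0 /ps_dilate.
  by rewrite /ps_of_poly /= f0 p0 !mulr1.
have eqv f : (f 0%N = 1 /\ E f =1 ps_of_poly 1) <->
    (forall m, c m * f m + Phi m f = 0).
  split=> [[f0 Ef] [|m]|fE].
  - by rewrite /= mul1r f0 subrr.
  - by rewrite -EE // Ef /ps_of_poly coef1.
  have f0 : f 0%N = 1 by have /eqP := fE 0%N; rewrite /= mul1r subr_eq0 => /eqP.
  by split=> // -[|m]; rewrite /ps_of_poly coef1 ?E0 ?EE // fE.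
have [f fE fU] := triangular_series c0 PhiE.
by exists f => [|g]; [apply/eqv | move/eqv/fU].
Qed.
End PowerSeries.

Variant classical_type := TypeB | TypeC | TypeD.

Definition rank_ok (ct : classical_type) (n : nat) : bool :=
  match ct with TypeD => (2 < n)%N | _ => (0 < n)%N end.

Definition dimN (ct : classical_type) (n : nat) : nat :=
  match ct with TypeB => n.*2.+1 | _ => n.*2 end.

(* Transcendental over the prime field of K, whatever the characteristic. *)
Definition transcendental (K : fieldType) (q : K) : Prop :=
  forall p : {poly int}, (map_poly intr p : {poly K}) != 0 ->
    ~~ root (map_poly intr p) q.

Section RMatrix.
Variables (K : fieldType) (q : K) (ct : classical_type) (n : nat).
Local Notation N := (dimN ct n).

Definition parv : K := match ct with TypeB => q ^ (- 2) | _ => q^-1 end.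

Definition parxi : K :=
  match ct with
  | TypeB => q ^ (2 - 4 * n%:Z)
  | TypeC => q ^ (- 2 - 2 * n%:Z)
  | TypeD => q ^ (2 - 2 * n%:Z)
  end.

(* The index i = 1, ..., N of the mathematics is a.+1 for a : 'I_N, so that
   i' = N + 1 - i is rev_ord a; idx gives back i. *)
Definition idx (a : 'I_N) : int := a.+1%:Z.
Local Notation "a ^'" := (rev_ord a) : ring_scope.

Definition tcoef (a : 'I_N) : K :=
  let i := idx a in
  match ct with
  | TypeB => if (i <= n%:Z) then q ^ (2 * (n%:Z - i) + 1)
             else if i == n%:Z + 1 then q
             else q ^ (2 * (n%:Z + 1 - i) + 1)
  | TypeC => if (i <= n%:Z) then q ^ (n%:Z + 1 - i) else - q ^ (n%:Z - i)
  | TypeD => if (i <= n%:Z) then q ^ (n%:Z - i) else q ^ (n%:Z + 1 - i)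
  end.

Definition EE (a b c d : 'I_N) : 'M[K]_(N * N) := delta_mx a b *t delta_mx c d.

Definition mid (a : 'I_N) : bool := idx a == n%:Z + 1.

Definition Rhat_B : 'M[K]_(N * N) :=
  q ^ (- 2) *: (\sum_(i < N | ~~ mid i) EE i i i i)
  + \sum_(i < N | mid i) EE i i i i
  + q ^ 2 *: (\sum_(i < N | ~~ mid i) EE i i^' i^' i)
  + \sum_(i < N) \sum_(j < N | (j != i) && (j != i^')) EE i j j i
  + (q ^ 2 - q ^ (- 2)) *:
      (\sum_(i < N | idx i <= n%:Z)
         (q ^ (4 * (n%:Z - idx i) + 2) - 1) *: EE i^' i^' i i)
  + (q ^ (- 2) - q ^ 2) *:
      (\sum_(i < N) \sum_(j < N | (j < i)%N && (j != i^')) EE i i j j)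
  + (q ^ 2 - q ^ (- 2)) *:
      (\sum_(i < N) \sum_(j < N | (i < j)%N && (j != i^'))
         (tcoef i / tcoef j) *: EE i^' j i j^').

Definition Rhat_CD : 'M[K]_(N * N) :=
  q^-1 *: (\sum_(i < N) EE i i i i)
  + q *: (\sum_(i < N) EE i i^' i^' i)
  + \sum_(i < N) \sum_(j < N | (j != i) && (j != i^')) EE i j j i
  + (q^-1 - q) *:
      (\sum_(i < N | idx i <= n%:Z)
         (if ct is TypeC then q ^ (2 * (n%:Z + 1 - idx i)) + 1
          else 1 - q ^ (2 * (n%:Z - idx i))) *: EE i^' i^' i i)
  + (q^-1 - q) *: (\sum_(i < N) \sum_(j < N | (j < i)%N && (j != i^')) EE i i j j)
  + (q - q^-1) *:
      (\sum_(i < N) \sum_(j < N | (i < j)%N && (j != i^'))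
         (tcoef i / tcoef j) *: EE i^' j i j^').

Definition Rhat : 'M[K]_(N * N) :=
  match ct with TypeB => Rhat_B | _ => Rhat_CD end.

Definition flip : 'M[K]_(N * N) := \sum_(i < N) \sum_(j < N) EE i j j i.

(* Matrices with coefficients in K[z], with 'X standing for z. *)
Definition Rhat_aff : 'M[{poly K}]_(N * N) :=
  (parv *: ('X * ('X - 1))) *: map_mx polyC (invmx Rhat)
  + ((1 - parxi) * (1 - parv ^+ 2)) *: 'X *: 1%:M
  - ((parxi * parv) *: ('X - 1)) *: map_mx polyC Rhat.

Definition R_aff : 'M[{poly K}]_(N * N) := Rhat_aff *m map_mx polyC flip.

(* The coefficient of z^m in f(z) R_q(z). *)
Definition Rtilde (f : nat -> K) (m : nat) : 'M[K]_(N * N) :=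
  \matrix_(r, c) ps_mul f (ps_of_poly (R_aff r c)) m.

(* c_a = crho_sign * q ^ crho, where crho is 2 rho_a in type B and rho_a in
   types C and D *)
Definition crho (a : 'I_N) : int :=
  let i := idx a in
  match ct with
  | TypeB => if (i <= n%:Z) then 2 * (n%:Z - i) + 1
             else if i == n%:Z + 1 then 1 else 2 * (n%:Z - i) + 3
  | TypeC => if (i <= n%:Z) then n%:Z + 1 - i else n%:Z - i
  | TypeD => if (i <= n%:Z) then n%:Z - i else n%:Z + 1 - i
  end.

Definition crho_sign (a : 'I_N) : K :=
  if ct is TypeC then if (idx a <= n%:Z) then 1 else -1 else 1.

Definition Cq : 'M[K]_N := diag_mx (\row_a (crho_sign a * q ^ crho a)).
End RMatrix.

Lemma normalizing_series_par (K : fieldType) (q : K) (ct : classical_type)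
    (n : nat) : transcendental q -> rank_ok ct n ->
  exists2 f, normalizing_series (parxi q ct n) (parv q ct) f &
    forall g, normalizing_series (parxi q ct n) (parv q ct) g -> g =1 f.
Proof.
move=> qT ctn; apply: normalizing_series_exists => k k0.
have q0 : q != 0.
  by have := qT (polyX _); rewrite map_polyX rootX; apply; rewrite polyX_eq0.
have [e e0 ->] : exists2 e : int, e != 0 & parxi q ct n = q ^ e.
  by move: ctn; rewrite /parxi; case: ct => n0; eexists; try reflexivity;
     apply/eqP => E; move: n0; apply/negP; rewrite -leqNgt; lia.
have aux m : (0 < m)%N -> 1 + q ^+ m != 0.
  move=> m0; have pE : map_poly intr ('X^m + 1%:P : {poly int}) = 'X^m + 1%:P :> {poly K}.
    by rewrite rmorphD /= map_polyXn map_polyC.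
  rewrite addrC; have := qT ('X^m + 1%:P); rewrite pE => /(_ _)/negP/negP.
  rewrite rootE hornerD hornerXn hornerC; apply.
  by rewrite -size_poly_eq0 size_XnaddC.
rewrite exprnP exprz_exp.
have [m m0 [->|->]] : exists2 m, (0 < m)%N &
    e * k%:Z = m%:Z \/ e * k%:Z = - m%:Z.
- exists (`|e| * k)%N; last by case: (intP e) => *; lia.
  by rewrite muln_gt0 absz_gt0 e0.
- exact: aux.
- have qm : q ^+ m != 0 by rewrite expf_neq0.
  have -> : 1 + q ^ (- m%:Z) = (q ^+ m)^-1 * (1 + q ^+ m).
    by rewrite -exprnN mulrDr mulr1 mulVf // addrC.
  by rewrite mulf_neq0 ?invr_neq0 ?aux.
Qed.

(* pm = true is the sign + and pm = false is the sign -.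
   - Gam p s is gamma^(1/2) (p = false) or gamma'^(1/2) (p = true), inverted when
     s = false;
   - Ell pm i j m is l^pm_ij[-m] when pm = + and l^pm_ij[m] when pm = -;
   - EllInv pm i is (l^pm_ii[0])^-1. *)
Inductive generator (N : nat) : Type :=
| Gam (p s : bool)
| Ell (pm : bool) (i j : 'I_N) (m : nat)
| EllInv (pm : bool) (i : 'I_N).
Arguments Gam {N}.
HB.instance Definition _ N := gen_eqMixin (generator N).
HB.instance Definition _ N := gen_choiceMixin (generator N).

Definition scal_mx (K : fieldType) (A : pzAlgType K) (m n : nat)
  (M : 'M[K]_(m, n)) : 'M[A]_(m, n) := map_mx scal M.

Section AlgebraU.
Variables (K : fieldType) (N : nat) (R : nat -> 'M[K]_(N * N)).
Local Notation F := (free_alg K (generator N)).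
Local Notation gen := (@fgen K (generator N)).

(* The coefficient of w^e in L^pm(w), for e of any sign. *)
Definition Lcoef (pm : bool) (e : int) : 'M[F]_N :=
  if (if pm then 0 <= e else e <= 0)
  then \matrix_(i, j) gen (Ell pm i j `|e|%N) else 0.
Definition L1 pm e : 'M[F]_(N * N) := Lcoef pm e *t 1%:M.
Definition L2 pm e : 'M[F]_(N * N) := 1%:M *t Lcoef pm e.

(* gamma (gamma gamma')^(1/2) and gamma' (gamma gamma')^(1/2) *)
Definition shift (p : bool) : F :=
  gen (Gam p true) ^+ 2 * (gen (Gam false true) * gen (Gam true true)).

(* The coefficients of z^a w^b in R(z u/w) L_1^pm(z) L_2^pm'(w) and in
   L_2^pm'(w) L_1^pm(z) R(z u/w). The summand of index k vanishes for k > a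
   if pm = +, and for k > -b if pm' = -, so that the range of the sum covers all
   nonzero terms in the three cases (+,+), (-,-), (+,-) used below. *)
Definition RLL (u : F) (pm pm' : bool) (a b : int) : 'M[F]_(N * N) :=
  \sum_(k < (`|a| + `|b|).+1)
     u ^+ k *: (scal_mx _ (R k) *m L1 pm (a - k%:Z) *m L2 pm' (b + k%:Z)).
Definition LLR (u : F) (pm pm' : bool) (a b : int) : 'M[F]_(N * N) :=
  \sum_(k < (`|a| + `|b|).+1)
     u ^+ k *: (L2 pm' (b + k%:Z) *m L1 pm (a - k%:Z) *m scal_mx _ (R k)).

Variant U_rel : F -> F -> Prop :=
| U_gam_inv p : U_rel (gen (Gam p true) * gen (Gam p false)) 1
| U_gam_central p s x : U_rel (gen (Gam p s) * gen x) (gen x * gen (Gam p s))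
| U_tri_plus (i j : 'I_N) : (i < j)%N -> U_rel (gen (Ell true i j 0)) 0
| U_tri_minus (i j : 'I_N) : (i < j)%N -> U_rel (gen (Ell false j i 0)) 0
| U_invr pm i : U_rel (gen (Ell pm i i 0) * gen (EllInv pm i)) 1
| U_invl pm i : U_rel (gen (EllInv pm i) * gen (Ell pm i i 0)) 1
| U_RLL pm a b r c : U_rel (RLL 1 pm pm a b r c) (LLR 1 pm pm a b r c)
| U_RLL_mixed a b r c :
    U_rel (RLL (shift false) true false a b r c)
          (LLR (shift true) true false a b r c).

Definition algU : pzAlgType K := quot_alg U_rel.
Definition genU (x : generator N) : algU := qpi U_rel (gen x).
End AlgebraU.

Section TildeU.
Variables (K : fieldType) (q : K) (ct : classical_type) (n : nat) (f : nat -> K).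
Local Notation N := (dimN ct n).
Local Notation U := (algU (Rtilde q ct n f)).
Local Notation genU := (genU (Rtilde q ct n f)).

Definition transp' (A : pzRingType) (M : 'M[A]_N) : 'M[A]_N :=
  \matrix_(i, j) M (rev_ord j) (rev_ord i).

Definition Lmat (pm : bool) (m : nat) : 'M[U]_N :=
  \matrix_(i, j) genU (Ell pm i j m).

(* The coefficient of z^m (pm = +) or z^-m (pm = -) in
   L^pm(z) C_q L^pm(z xi)^t' C_q^-1. *)
Definition LCLC (pm : bool) (m : nat) : 'M[U]_N :=
  \sum_(k < m.+1)
    (scal (parxi q ct n ^ (if pm then (m - k)%N%:Z else - (m - k)%N%:Z)) : U) *:
      (Lmat pm k *m scal_mx _ (Cq q ct n) *m transp' (Lmat pm (m - k))
       *m scal_mx _ (invmx (Cq q ct n))).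

Variant Ut_rel : U -> U -> Prop :=
| Ut_unit pm m i j : Ut_rel (LCLC pm m i j) (((m == 0%N) && (i == j))%:R)
| Ut_mid pm i : ct = TypeB -> mid i -> Ut_rel (genU (Ell pm i i 0)) 1.

Definition algUt : pzAlgType K := quot_alg Ut_rel.
Definition genUt (x : generator N) : algUt := qpi Ut_rel (genU x).

Variant Ut'_rel : algUt -> algUt -> Prop :=
| Ut'_gam : Ut'_rel (genUt (Gam true true)) (genUt (Gam false false))
| Ut'_ell pm i : Ut'_rel (genUt (EllInv pm i)) (genUt (Ell (~~ pm) i i 0)).

Definition algUt' : pzAlgType K := quot_alg Ut'_rel.
Definition genUt' (x : generator N) : algUt' := qpi Ut'_rel (genUt x).
End TildeU.

Section Weights.
Variables (ct : classical_type) (n : nat).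

(* The weight c_0 delta + \sum_i c_i epsilon_i is the row (c_0, c_1, ..., c_n). *)
Definition wdelta : 'rV[int]_n.+1 := delta_mx 0 ord0.
Definition weps (k : nat) : 'rV[int]_n.+1 := \row_j (j == k.+1 :> nat)%:R.
Definition epsilon (i : 'I_(dimN ct n)) : 'rV[int]_n.+1 :=
  if (i < n)%N then weps i
  else if (rev_ord i < n)%N then - weps (rev_ord i) else 0.
End Weights.

(* Main.v *)
(* U~ is graded by the lattice of weights, and eta sends a homogeneous x of degree mu to
   (image of x) (x) L_mu. It exists because all relations are homogeneous: the R-matrix
   preserves weights, and in the mixed relation each factor z/w comes with
   gamma (gamma gamma')^(1/2) or gamma' (gamma gamma')^(1/2), of degree -4 delta.

   For injectivity, the elements zeta_i = l^+_ii[0] l^-_ii[0], of degree -4 epsilon_i, are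
   central: the constant term of the R-matrix is triangular with diagonal entries
   D_ab = D_ba, so that l^+_aa[0] and l^-_aa[0] commute with every l^(+-)_cd[m] up to
   inverse scalars. Moreover zeta_i zeta_i' = 1, by the relation with C_q. Embed U~ in an
   extension A where the zeta_i have central fourth roots and (gamma gamma')^(1/2) has a
   central square root. The roots define a homomorphism K[L^(+-1)] -> A; dividing each
   homogeneous element of U~ by the root of the same degree gives a homomorphism
   U~' -> A; together they give U~' (x) K[L^(+-1)] -> A, whose composition with eta is
   the embedding of U~ in A. *)
From HB Require Import structures.
From mathcomp Require Import all_boot all_order all_algebra.
From mathcomp Require Import boolp mxtens zify.
Require Import Defs.
Set Implicit Arguments.
Unset Strict Implicit.
Unset Printing Implicit Defensive.
Import GRing.Theory.
Local Open Scope ring_scope.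

(** * Algebra homomorphisms, tensor products and Laurent polynomials *)

Section AlgHom.
Variables (K : pzRingType) (A B : pzAlgType K) (h : A -> B).
Hypothesis hh : is_alg_hom h.

Lemma alg_homB : {morph h : x y / x - y}. Proof. by case: hh. Qed.
Lemma alg_hom0 : h 0 = 0. Proof. by rewrite -(subrr 0) alg_homB subrr. Qed.
Lemma alg_homD : {morph h : x y / x + y}.
Proof.
move=> x y; have hN z : h (- z) = - h z by rewrite -sub0r alg_homB alg_hom0 sub0r.
by rewrite -{1}[y]opprK alg_homB hN opprK.
Qed.
Lemma alg_hom1 : h 1 = 1. Proof. by case: hh => _ []. Qed.
Lemma alg_homM : {morph h : x y / x * y}. Proof. by case: hh => _ []. Qed.
Lemma alg_homX k : {morph h : x / x ^+ k}.
Proof.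
by move=> x; elim: k => [|k IHk]; rewrite ?expr0 ?alg_hom1 // !exprS alg_homM IHk.
Qed.
Lemma alg_hom_scal k : h (scal k) = scal k. Proof. by case: hh. Qed.
Lemma alg_hom_sum I r (P : pred I) F :
  h (\sum_(i <- r | P i) F i) = \sum_(i <- r | P i) h (F i).
Proof. exact: (big_morph h alg_homD alg_hom0). Qed.
End AlgHom.

Lemma alg_hom_comp (K : pzRingType) (A B C : pzAlgType K) (g : B -> C) (h : A -> B) :
  is_alg_hom g -> is_alg_hom h -> is_alg_hom (g \o h).
Proof.
move=> gg hh; split=> [x y||k] /=; first by rewrite !alg_homB.
  by split=> [|x y] /=; rewrite ?alg_hom1 ?alg_homM.
by rewrite !alg_hom_scal.
Qed.

Lemma alg_hom_id (K : pzRingType) (A : pzAlgType K) : is_alg_hom (@id A).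
Proof. by []. Qed.

Section Scal.
Variables (K : pzRingType) (A : pzAlgType K).
Lemma scal0 : scal 0 = 0 :> A.
Proof. by have aB := @scal_zmod K A; rewrite -(subrr 0) aB subrr. Qed.
Lemma scal1 : scal 1 = 1 :> A. Proof. by case: (@scal_monoid K A). Qed.
Lemma scalM (k l : K) : scal (k * l) = scal k * scal l :> A.
Proof. by case: (@scal_monoid K A). Qed.
Lemma scalB (k l : K) : scal (k - l) = scal k - scal l :> A.
Proof. exact: scal_zmod. Qed.
End Scal.

Lemma scalI (K : fieldType) (A : pzAlgType K) (k : K) (x y : A) :
  k != 0 -> scal k * x = scal k * y -> x = y.
Proof.
move=> k0 E; rewrite -[x]mul1r -[y]mul1r -(scal1 A) -(mulVf k0) scalM -!mulrA.
by rewrite E.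
Qed.

(** The elements whose image commutes with [c] form a subalgebra, so the generators suffice. The
    centrality of the elements [zetaU i] and of the images of Laurent polynomials rests on this. *)
Lemma free_comm (K : fieldType) (X : choiceType) (C : pzAlgType K)
    (p : free_alg K X -> C) (c : C) :
  is_alg_hom p -> (forall x, p (fgen K x) * c = c * p (fgen K x)) ->
  forall a, p a * c = c * p a.
Proof.
move=> hp pc; apply: free_ind => [x y px py|k|x y py|k y py].
- by rewrite (alg_homD hp) mulrDl mulrDr px py.
- by rewrite (alg_hom_scal hp) scal_central.
- by rewrite (alg_homM hp) -mulrA py !mulrA pc.
- by rewrite (alg_homM hp) (alg_hom_scal hp) -mulrA py mulrA scal_central mulrA.
Qed.

Lemma quot_free_hom_unique (K : fieldType) (X : choiceType)
    (rel : free_alg K X -> free_alg K X -> Prop) (C : pzAlgType K)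
    (g h : quot_alg rel -> C) :
  is_alg_hom g -> is_alg_hom h ->
  (forall x, g (qpi rel (fgen K x)) = h (qpi rel (fgen K x))) -> g =1 h.
Proof.
move=> gg hh gh; apply: quot_hom_unique; have pp := qpi_hom rel.
exact: (free_hom_unique (alg_hom_comp gg pp) (alg_hom_comp hh pp)).
Qed.

Lemma quot_free_comm (K : fieldType) (X : choiceType)
    (rel : free_alg K X -> free_alg K X -> Prop) (C : pzAlgType K)
    (g : quot_alg rel -> C) (c : C) :
  is_alg_hom g -> (forall x, g (qpi rel (fgen K x)) * c = c * g (qpi rel (fgen K x))) ->
  forall a, g a * c = c * g a.
Proof.
move=> gg gc a; have [x ->] := qpi_surj a.
exact: (free_comm (alg_hom_comp gg (qpi_hom rel)) gc).
Qed.

Lemma alg_homI (K : pzRingType) (A B : pzAlgType K) (h : A -> B) :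
  {morph h : x y / x + y} -> {morph h : x y / x * y} ->
  (forall k, h (scal k) = scal k) -> is_alg_hom h.
Proof.
move=> hD hM hC; split=> // [x y|]; first by apply: (addIr (h y)); rewrite -hD !subrK.
by split=> //; rewrite -(scal1 A) hC scal1.
Qed.

Section TensorTheory.
Variables (K : fieldType) (A B : pzAlgType K).
Implicit Types (a : A) (b : B).
Local Notation inA a := (@fgen K (A + B)%type (inl a)).
Local Notation inB b := (@fgen K (A + B)%type (inr b)).

Let pi : free_alg K (A + B)%type -> tensor A B := qpi (@tensor_rel K A B).

Let piH : is_alg_hom pi := qpi_hom _.
Let piE x y : tensor_rel x y -> pi x = pi y := @qpi_rel _ _ _ x y.

Let inAH : is_alg_hom (fun a => pi (inA a)).
Proof.
apply: alg_homI => [a a'|a a'|k].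
- by rewrite (piE (@tl_add K A B _ _)) (alg_homD piH).
- by rewrite (piE (@tl_mul K A B _ _)) (alg_homM piH).
- by rewrite (piE (@tl_scal K A B _)) (alg_hom_scal piH).
Qed.

Let inBH : is_alg_hom (fun b => pi (inB b)).
Proof.
apply: alg_homI => [b b'|b b'|k].
- by rewrite (piE (@tr_add K A B _ _)) (alg_homD piH).
- by rewrite (piE (@tr_mul K A B _ _)) (alg_homM piH).
- by rewrite (piE (@tr_scal K A B _)) (alg_hom_scal piH).
Qed.

Let tensE a b : tens a b = pi (inA a) * pi (inB b) := alg_homM piH _ _.

Let tensA a : tens a 1 = pi (inA a).
Proof. by rewrite tensE (alg_hom1 inBH) mulr1. Qed.

Let tensB b : tens 1 b = pi (inB b).
Proof. by rewrite tensE (alg_hom1 inAH) mul1r. Qed.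

Lemma tensl_hom : is_alg_hom (fun a => tens a 1 : tensor A B).
Proof.
have -> : (fun a => tens a 1) = (fun a => pi (inA a)) by apply/funext.
exact: inAH.
Qed.

Lemma tensr_hom : is_alg_hom (fun b => tens 1 b : tensor A B).
Proof.
have -> : (fun b => tens 1 b) = (fun b => pi (inB b)) by apply/funext.
exact: inBH.
Qed.

Lemma tens_split a b : tens a b = tens a 1 * tens 1 b :> tensor A B.
Proof. by rewrite tensA tensB; exact: tensE. Qed.

Lemma tens_comm a b : tens a 1 * tens 1 b = tens 1 b * tens a 1 :> tensor A B.
Proof.
rewrite tensA tensB -(alg_homM piH) (piE (@t_comm K A B a b)); exact: alg_homM.
Qed.
End TensorTheory.

Lemma prod_mul_comm (R : pzRingType) I (r : seq I) (F G : I -> R) :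
  (forall i j, F i * G j = G j * F i) ->
  \prod_(i <- r) (F i * G i) = (\prod_(i <- r) F i) * (\prod_(i <- r) G i).
Proof.
move=> FG; elim: r => [|i r IHr]; first by rewrite !big_nil mulr1.
rewrite !big_cons {}IHr -!mulrA; congr (_ * _); rewrite !mulrA; congr (_ * _).
(* What remains is to move [G i] past the product of the other [F j]. *)
elim: r => [|j r IHr]; first by rewrite !big_nil mul1r mulr1.
by rewrite big_cons -mulrA -IHr !mulrA FG.
Qed.

(* Integer powers of x in a ring where x^-1 is not available; y is the inverse of x. *)
Lemma signed_expD (R : pzRingType) (x y : R) (e : int -> R) :
  x * y = 1 -> y * x = 1 ->
  (forall a, e a = (if 0 <= a then x else y) ^+ `|a|%N) ->
  {morph e : a b / a + b >-> a * b}.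
Proof.
move=> xy yx eE.
(* By induction on the second exponent, the rules for adding and subtracting 1 suffice. *)
have eS a : e (a + 1) = e a * x.
  rewrite !eE; case: (intP a) => [|k|k]; first by rewrite mul1r.
    have -> : (k.+1%:Z + 1)%R = k.+2%:Z by lia.
    by rewrite /= exprSr.
  have -> : (- k.+1%:Z + 1)%R = - k%:Z by lia.
  by rewrite !abszN exprSr -mulrA yx mulr1; case: k.
have eP a : e (a - 1) = e a * y by rewrite -[a in RHS](subrK 1) eS -mulrA xy mulr1.
move=> a b; elim/int_ind: b => [|k IHk|k IHk].
- by rewrite addr0 [e 0]eE mulr1.
- by rewrite -[k.+1]addn1 PoszD addrA !eS IHk mulrA.
- by rewrite -[k.+1]addn1 PoszD opprD addrA !eP IHk mulrA.
Qed.

Section LaurentTheory.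
Variables (K : fieldType) (m : nat).
Local Notation L := (laurent K m).
Let pi : free_alg K ('I_m * bool)%type -> L := qpi (@laurent_rel K m).
Let piH : is_alg_hom pi := qpi_hom _.
Let piE x y : laurent_rel x y -> pi x = pi y := @qpi_rel _ _ _ x y.

Lemma laurent_commutative (x y : L) : x * y = y * x.
Proof.
(* First [x] is reduced to a generator with [y] fixed, then [y] is. *)
apply: (quot_free_comm (g := id) (c := y) (alg_hom_id L)) => i.
apply/esym; move: y; apply: (quot_free_comm (g := id) (alg_hom_id L)) => j.
rewrite -[LHS](alg_homM piH) -[RHS](alg_homM piH).
exact: piE (@laurent_comm K m _ _).
Qed.

Lemma lvarV i : lvar K i true * lvar K i false = 1 :> L.
Proof.
rewrite -[LHS](alg_homM piH) (piE (@laurent_inv K m i)); exact: alg_hom1 piH.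
Qed.

Lemma lmonom0 : lmonom K 0 = 1 :> L.
Proof. by apply: big1 => i _; rewrite mxE. Qed.

Lemma lmonomD (mu nu : 'rV[int]_m) : lmonom K (mu + nu) = lmonom K mu * lmonom K nu.
Proof.
rewrite /lmonom -prod_mul_comm; last by move=> i j; apply: laurent_commutative.
apply: eq_bigr => i _; rewrite mxE.
(* [e a] is the integer power of the [i]-th variable: the boolean chooses between the variable and
   its inverse. *)
pose e (a : int) := lvar K i (0 <= a) ^+ `|a|%N.
apply: (@signed_expD _ (lvar K i true) (lvar K i false) e).
- exact: lvarV.
- by rewrite laurent_commutative lvarV.
- by move=> a; rewrite /e; case: (0 <= a).
Qed.

End LaurentTheory.

(** * Adjoining central roots *)

Definition central (R : pzRingType) (c : R) := forall x, c * x = x * c.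

(* B[t] / (t^2 - c) for a central c, with (a, b) standing for a + b t. *)
Definition sqrt_ext (K : pzRingType) (B : pzAlgType K) (c : B) (cc : central c) : Type :=
  (B * B)%type.

Section SqrtExt.
Variables (K : pzRingType) (B : pzAlgType K) (c : B) (cc : central c).
Local Notation E := (sqrt_ext cc).
HB.instance Definition _ := GRing.Zmodule.on E.

Definition sqrt_mul (x y : E) : E :=
  (x.1 * y.1 + c * (x.2 * y.2), x.1 * y.2 + x.2 * y.1).

Fact sqrt_mulA : associative sqrt_mul.
Proof.
move=> [a b] [a' b'] [a'' b'']; congr (_, _) => /=;
  rewrite !mulrDl !mulrDr !mulrA -?(cc a) -?(cc b) -!addrA; congr (_ + _).
- by rewrite addrA addrC.
- by rewrite [RHS]addrC addrA.
Qed.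

Fact sqrt_mul1 : left_id (1, 0) sqrt_mul.
Proof. by move=> [a b]; rewrite /sqrt_mul /= !mul1r !mul0r mulr0 !addr0. Qed.

Fact sqrt_1mul : right_id (1, 0) sqrt_mul.
Proof. by move=> [a b]; rewrite /sqrt_mul /= !mulr1 !mulr0 !addr0 add0r. Qed.

Fact sqrt_mulDl : left_distributive sqrt_mul +%R.
Proof.
by move=> [a b] [a' b'] [a'' b'']; congr (_, _); rewrite /= !mulrDl ?mulrDr addrACA.
Qed.

Fact sqrt_mulDr : right_distributive sqrt_mul +%R.
Proof.
by move=> [a b] [a' b'] [a'' b'']; congr (_, _); rewrite /= !mulrDr addrACA.
Qed.

HB.instance Definition _ := GRing.Zmodule_isPzRing.Build E
  sqrt_mulA sqrt_mul1 sqrt_1mul sqrt_mulDl sqrt_mulDr.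

Definition sqrt_in (b : B) : E := (b, 0).
Definition sqrt_root : E := (0, 1).

Fact sqrt_inB : zmod_morphism sqrt_in.
Proof. by move=> a b; congr (_, _); rewrite subr0. Qed.

Fact sqrt_inM : {morph sqrt_in : a b / a * b}.
Proof. by move=> a b; congr (_, _); rewrite /= ?mulr0 ?mul0r ?mulr0 !addr0. Qed.

Fact sqrt_in_central b : central b -> central (sqrt_in b).
Proof.
by move=> bc [x y]; congr (_, _); rewrite /= ?mulr0 ?mul0r ?mulr0 ?addr0 ?add0r bc.
Qed.

HB.instance Definition _ := isPzAlgebra.Build K E
  (fun k l => etrans (congr1 sqrt_in (scalB B k l)) (sqrt_inB _ _))
  (conj (congr1 sqrt_in (scal1 B))
     (fun k l => etrans (congr1 sqrt_in (scalM B k l)) (sqrt_inM _ _)))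
  (fun k => sqrt_in_central (@scal_central K B k)).

Lemma sqrt_in_hom : is_alg_hom sqrt_in.
Proof. by split=> //; [exact: sqrt_inB | split=> //; exact: sqrt_inM]. Qed.

Lemma sqrt_in_inj : injective sqrt_in.
Proof. by move=> a b []. Qed.

Lemma sqrt_root_central : central sqrt_root.
Proof.
move=> [x y]; congr (_, _) => /=.
  by rewrite !mul0r mulr0 mul1r mulr1.
by rewrite mul0r mulr0 mul1r mulr1 add0r addr0.
Qed.

Lemma sqrt_rootK : sqrt_root ^+ 2 = sqrt_in c.
Proof. by congr (_, _); rewrite /= ?mulr1 ?mul0r ?mulr0 ?add0r. Qed.
End SqrtExt.

Section Roots.
Variables (K : pzRingType).

(** Preservation of central elements is part of the notion: after one root is adjoined, the other
    elements must still be central for their roots to be adjoined too. *)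
Record embedding (A B : pzAlgType K) (h : A -> B) : Prop := Embedding {
  embedding_hom : is_alg_hom h;
  embedding_inj : injective h;
  embedding_central : forall c, central c -> central (h c) }.

Lemma embedding_comp (A B C : pzAlgType K) (g : B -> C) (h : A -> B) :
  embedding g -> embedding h -> embedding (g \o h).
Proof.
move=> [gg gi gc] [hh hi hc]; split; first exact: alg_hom_comp.
- exact: inj_comp.
- by move=> c /hc /gc.
Qed.

(** The roots are adjoined one after another along [r]. Off [r] the values of [s] need only be
    central, so [c] itself serves for the empty list. *)
Lemma sqrt_family (I : eqType) (r : seq I) (B : pzAlgType K) (c : I -> B) :
  (forall i, central (c i)) ->
  exists (A : pzAlgType K) (h : B -> A) (s : I -> A), [/\ embedding h,
    forall i, central (s i) & forall i, i \in r -> s i ^+ 2 = h (c i)].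
Proof.
elim: r B c => [|j r IHr] B c cc; first by exists B, id, c; split=> //; split.
pose h0 := @sqrt_in _ _ _ (cc j).
have e0 : embedding h0.
  by split; [exact: sqrt_in_hom | exact: sqrt_in_inj | exact: sqrt_in_central].
have [i|A [h [s [eh sc s2]]]] := IHr _ (h0 \o c).
  exact: (embedding_central e0 (cc i)).
exists A, (h \o h0), (fun i => if i == j then h (sqrt_root (cc j)) else s i); split.
- exact: embedding_comp.
- by move=> i; case: ifP => // _; apply/(embedding_central eh)/sqrt_root_central.
- move=> i; rewrite inE; case: ifP => [/eqP -> _|_ /s2 //].
  by rewrite -(alg_homX (embedding_hom eh)) sqrt_rootK.
Qed.

(** The square roots are again central, so square roots of them can be adjoined in turn. *)
Lemma fourth_root_family (I : finType) (B : pzAlgType K) (c : I -> B) :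
  (forall i, central (c i)) ->
  exists (A : pzAlgType K) (h : B -> A) (s : I -> A), [/\ embedding h,
    forall i, central (s i) & forall i, s i ^+ 4 = h (c i)].
Proof.
move=> cc; have [A [h [s [eh sc s2]]]] := sqrt_family (enum I) cc.
have [A' [h' [s' [eh' sc' s2']]]] := sqrt_family (enum I) sc.
exists A', (h' \o h), s'; split=> // [|i]; first exact: embedding_comp.
rewrite (exprM _ 2 2) s2' ?mem_enum // -(alg_homX (embedding_hom eh')).
by rewrite s2 ?mem_enum.
Qed.
End Roots.

(** * Weights and triangularity of the R-matrix *)

Section GradedMatrix.
Variables (V : eqType) (m : nat) (w : 'I_m -> V).

(** Such a matrix preserves the weight decomposition. The case [w = id] means that it is diagonal,
    and is used for [Cq]. *)
Definition graded_mx (R : pzRingType) (M : 'M[R]_m) :=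
  forall r s, M r s != 0 -> w r = w s.

Lemma graded_mxD (R : pzRingType) (M P : 'M[R]_m) :
  graded_mx M -> graded_mx P -> graded_mx (M + P).
Proof.
move=> gM gP r s; rewrite mxE; have [->|/gM //] := eqVneq (M r s) 0.
by rewrite add0r; apply: gP.
Qed.

Lemma graded_mxN (R : pzRingType) (M : 'M[R]_m) : graded_mx M -> graded_mx (- M).
Proof. by move=> gM r s; rewrite mxE oppr_eq0; apply: gM. Qed.

Lemma graded_mxZ (R : pzRingType) (a : R) (M : 'M[R]_m) :
  graded_mx M -> graded_mx (a *: M).
Proof.
move=> gM r s; rewrite mxE; have [->|/gM //] := eqVneq (M r s) 0.
by rewrite mulr0 eqxx.
Qed.

Lemma graded_mx_sum (R : pzRingType) I (r : seq I) (P : pred I) (F : I -> 'M[R]_m) :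
  (forall i, P i -> graded_mx (F i)) -> graded_mx (\sum_(i <- r | P i) F i).
Proof.
move=> gF; elim/big_ind: _ => //; last exact: graded_mxD.
by move=> i j; rewrite mxE eqxx.
Qed.

Lemma graded_mx1 (R : pzRingType) : graded_mx (1%:M : 'M[R]_m).
Proof. by move=> r s; rewrite mxE; case: (eqVneq r s) => [->|_] //=; rewrite eqxx. Qed.

Lemma graded_mxM (R : pzRingType) (M P : 'M[R]_m) :
  graded_mx M -> graded_mx P -> graded_mx (M *m P).
Proof.
move=> gM gP r s; apply: contraTeq => rs; rewrite mxE big1 ?eqxx // => t _.
have [->|/gM rt] := eqVneq (M r t) 0; first by rewrite mul0r.
have [->|/gP ts] := eqVneq (P t s) 0; first by rewrite mulr0.
by rewrite rt ts eqxx in rs.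
Qed.

Lemma graded_map_mx (R S : pzRingType) (f : R -> S) (M : 'M[R]_m) :
  f 0 = 0 -> graded_mx M -> graded_mx (map_mx f M).
Proof.
move=> f0 gM r s; rewrite mxE; have [->|/gM //] := eqVneq (M r s) 0.
by rewrite f0 eqxx.
Qed.

(* M is graded iff it commutes with the projections on the graded pieces. When M is not
   invertible, invmx M is M itself. *)
Lemma graded_invmx (K : fieldType) (M : 'M[K]_m) : graded_mx M -> graded_mx (invmx M).
Proof.
move=> gM; have [uM|nuM] := boolP (M \in unitmx); last first.
  by rewrite /invmx (negPf nuM).
pose P v : 'M[K]_m := diag_mx (\row_r (w r == v)%:R).
have PM v : P v *m M = M *m P v.
  apply/matrixP => r s; rewrite mul_diag_mx mul_mx_diag !mxE mulrC.
  have [->|/gM -> //] := eqVneq (M r s) 0; by rewrite !mul0r.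
have PV v : P v *m invmx M = invmx M *m P v.
  rewrite -[LHS](mulKmx uM); congr (_ *m _).
  by rewrite mulmxA -PM -mulmxA mulmxV // mulmx1.
move=> r s nz; have /matrixP/(_ r s) := PV (w r).
rewrite mul_diag_mx mul_mx_diag !mxE eqxx mul1r.
have [//|_] := eqVneq (w s) (w r).
by move=> E; rewrite E mulr0 eqxx in nz.
Qed.
End GradedMatrix.

Section RWeights.
Variables (K : fieldType) (q : K) (ct : classical_type) (n : nat).
Local Notation N := (dimN ct n).
Local Notation eps := (@epsilon ct n).

(** As [2n <= N], the indices [i] and [i'] cannot both be among the first [n]. *)
Lemma epsilon_rev (i : 'I_N) : eps (rev_ord i) = - eps i.
Proof.
have HN : (n.*2 <= N)%N by rewrite /dimN; case: ct.
rewrite /epsilon rev_ordK; case: (ltnP i n) => Hi;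
  case: (ltnP (rev_ord i) n) => Hj; rewrite ?opprK ?oppr0 //.
by move: Hi Hj HN; rewrite /=; lia.
Qed.

Definition pair_wt (r : 'I_(N * N)) : 'rV[int]_n.+1 :=
  eps (mxtens_unindex r).1 + eps (mxtens_unindex r).2.

Lemma EE_entry a b c d (x y z t : 'I_N) :
  EE K a b c d (mxtens_index (x, z)) (mxtens_index (y, t)) =
  ((x == a) && (y == b) && ((z == c) && (t == d)))%:R.
Proof. by rewrite tensmxE !mxE -natrM mulnb. Qed.

Lemma graded_EE a b c d :
  eps a + eps c = eps b + eps d -> graded_mx pair_wt (EE K a b c d).
Proof.
move=> E r s; case: (mxtens_indexP r) => x z; case: (mxtens_indexP s) => y t.
rewrite EE_entry /pair_wt !mxtens_indexK /=.
case: andP => [[/andP[/eqP-> /eqP->] /andP[/eqP-> /eqP->]] //|_]; by rewrite eqxx.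
Qed.

(** Reduces the claim to a weight identity for each matrix unit, which holds because [i'] has the
    weight opposite to that of [i]. *)
Ltac graded :=
  repeat first [apply: graded_mxD | apply: graded_mxZ | apply: graded_mx_sum => ? ?];
  apply: graded_EE; rewrite ?epsilon_rev ?subrr ?addNr //; try exact: addrC.

Lemma graded_Rhat_B : graded_mx pair_wt (Rhat_B q ct n).
Proof. by rewrite /Rhat_B; graded. Qed.

Lemma graded_Rhat_CD : graded_mx pair_wt (Rhat_CD q ct n).
Proof. by rewrite /Rhat_CD; graded. Qed.

(** The parity of [N] is recorded because it decides whether [i = i'] can occur. *)
Lemma Rhat_cases :
  (N = n.*2.+1 /\ Rhat q ct n = Rhat_B q ct n) \/
  (N = n.*2 /\ Rhat q ct n = Rhat_CD q ct n).
Proof. by rewrite /Rhat; case: ct; [left | right | right]. Qed.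

Lemma graded_Rhat : graded_mx pair_wt (Rhat q ct n).
Proof.
by case: Rhat_cases => -[_ ->]; [exact: graded_Rhat_B | exact: graded_Rhat_CD].
Qed.

Lemma graded_flip : graded_mx pair_wt (flip K ct n).
Proof. by rewrite /flip; graded. Qed.

Lemma graded_R_aff : graded_mx pair_wt (R_aff q ct n).
Proof.
apply: graded_mxM; last by apply: graded_map_mx graded_flip; rewrite polyC0.
apply: graded_mxD.
  apply: graded_mxD; apply: graded_mxZ; last exact: graded_mx1.
  by apply: graded_map_mx; [rewrite polyC0 | apply/graded_invmx/graded_Rhat].
by apply/graded_mxN/graded_mxZ/graded_map_mx; [rewrite polyC0 | exact: graded_Rhat].
Qed.

Lemma graded_Rtilde (f : nat -> K) k : graded_mx pair_wt (Rtilde q ct n f k).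
Proof.
move=> r s; rewrite mxE; have [->|/graded_R_aff //] := eqVneq (R_aff q ct n r s) 0.
by rewrite /ps_mul big1 ?eqxx // => j _; rewrite /ps_of_poly coef0 mulr0.
Qed.

(** At [z = 0] the terms with the inverse of [Rhat] and with the identity vanish, and
    [-xi v (z - 1) Rhat] becomes [xi v Rhat]. *)
Lemma Rtilde0 (f : nat -> K) : f 0%N = 1 ->
  Rtilde q ct n f 0 = (parxi q ct n * parv q ct) *: (Rhat q ct n *m flip K ct n).
Proof.
move=> f0; apply/matrixP => r s; rewrite !mxE /ps_mul big_ord1 f0 mul1r subnn.
rewrite /ps_of_poly coef_sum mulr_sumr; apply: eq_bigr => t _.
rewrite [map_mx polyC _ t s]mxE coefMC mulrA; congr (_ * _).
rewrite !mxE coefB coefD !(coefCM, coefMC, coefZ, coefB, coefX, coefC, coefXM, coef0) /=.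
rewrite -scalerAl coefZ coefXM /= sub0r !mulr0 !mul0r addr0 add0r.
by rewrite mulrN1 mulNr opprK.
Qed.

(** The condition is on [M] before composition with the flip, which exchanges the column indices [y]
    and [t]. After it, the first tensor factor is strictly lower and the second strictly upper
    triangular. *)
Definition strict_mx (M : 'M[K]_(N * N)) := forall x y z t,
  M (mxtens_index (x, z)) (mxtens_index (y, t)) != 0 -> (t < x)%N && (z < y)%N.

Lemma strict_mxD M P : strict_mx M -> strict_mx P -> strict_mx (M + P).
Proof.
move=> sM sP x y z t; rewrite mxE.
have [->|nz _] := eqVneq (M (mxtens_index (x, z)) (mxtens_index (y, t))) 0.
  by rewrite add0r; apply: sP.
exact: sM nz.
Qed.

Lemma strict_mxZ a M : strict_mx M -> strict_mx (a *: M).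
Proof.
move=> sM x y z t; rewrite mxE.
have [->|nz _] := eqVneq (M (mxtens_index (x, z)) (mxtens_index (y, t))) 0.
  by rewrite mulr0 eqxx.
exact: sM nz.
Qed.

Lemma strict_mx_sum I (r : seq I) (P : pred I) (F : I -> 'M[K]_(N * N)) :
  (forall i, P i -> strict_mx (F i)) -> strict_mx (\sum_(i <- r | P i) F i).
Proof.
move=> gF; elim/big_ind: _ => //; last exact: strict_mxD.
by move=> ? ? ? ?; rewrite mxE eqxx.
Qed.

Lemma strict_EE (a b c d : 'I_N) : (d < a)%N -> (c < b)%N -> strict_mx (EE K a b c d).
Proof.
move=> da cb x y z t; rewrite EE_entry.
case: andP => [[/andP[/eqP-> /eqP->] /andP[/eqP-> /eqP->]] _|_]; last by rewrite eqxx.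
by rewrite da.
Qed.

(** Taking [phi] to be the identity or [rev_ord] gives the first sums in the R-matrix. They become
    diagonal after composition with the flip. *)
Lemma diag_EE_sum (P : pred 'I_N) (phi : 'I_N -> 'I_N) x y z t :
  (\sum_(i | P i) EE K i (phi i) (phi i) i) (mxtens_index (x, z)) (mxtens_index (y, t))
  = ((t == x) && (y == z))%:R * (P x && (z == phi x))%:R.
Proof.
rewrite summxE big_mkcond (bigD1 x) //= big1 ?addr0 => [|i ix]; last first.
  by rewrite EE_entry eq_sym (negPf ix); case: ifP.
rewrite EE_entry eqxx; case: (P x) => /=; rewrite ?mulr0 // -natrM mulnb.
by congr (_%:R); case: (eqVneq z (phi x)) => [->|]; rewrite ?andbF ?andbT // andbC.
Qed.

Lemma diag_EE_sum2 (Q : rel 'I_N) x y z t :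
  (\sum_i \sum_(j | Q i j) EE K i j j i) (mxtens_index (x, z)) (mxtens_index (y, t))
  = ((t == x) && (y == z))%:R * (Q x z)%:R.
Proof.
rewrite summxE (bigD1 x) //= [X in _ + X]big1 ?addr0 => [|i ix]; last first.
  by rewrite summxE big1 // => j _; rewrite EE_entry eq_sym (negPf ix).
rewrite summxE big_mkcond (bigD1 z) //= big1 ?addr0 => [|j jz]; last first.
  by rewrite EE_entry [z == j]eq_sym (negPf jz) !andbF; case: ifP.
by rewrite EE_entry !eqxx; case: (Q x z); rewrite ?mulr0 ?mulr1 //= andbC.
Qed.

(* In tensor notation: M composed with the flip is diagonal with entries D plus
   strictly lower triangular matrices tensor strictly upper triangular ones. *)
Definition triangular_mx (D : 'I_N -> 'I_N -> K) (M : 'M[K]_(N * N)) :=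
  exists2 S, strict_mx S & forall x y z t,
    M (mxtens_index (x, z)) (mxtens_index (y, t)) =
    ((t == x) && (y == z))%:R * D x z + S (mxtens_index (x, z)) (mxtens_index (y, t)).

Lemma triangular_mxD D M D' M' : triangular_mx D M -> triangular_mx D' M' ->
  triangular_mx (fun x z => D x z + D' x z) (M + M').
Proof.
move=> [S sS SE] [S' sS' SE']; exists (S + S'); first exact: strict_mxD.
by move=> x y z t; rewrite !mxE SE SE' mulrDr addrACA.
Qed.

Lemma triangular_mxZ a D M : triangular_mx D M ->
  triangular_mx (fun x z => a * D x z) (a *: M).
Proof.
move=> [S sS SE]; exists (a *: S); first exact: strict_mxZ.
by move=> x y z t; rewrite !mxE SE mulrDr mulrCA.
Qed.

Lemma triangular_strict M : strict_mx M -> triangular_mx (fun _ _ => 0) M.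
Proof. by move=> sM; exists M => // *; rewrite mulr0 add0r. Qed.

Lemma strict_mx0 : strict_mx 0.
Proof. by move=> ? ? ? ?; rewrite mxE eqxx. Qed.

Lemma triangular_diag (P : pred 'I_N) (phi : 'I_N -> 'I_N) :
  triangular_mx (fun x z => (P x && (z == phi x))%:R)
    (\sum_(i | P i) EE K i (phi i) (phi i) i).
Proof.
exists 0 => [|x y z t]; first exact: strict_mx0.
by rewrite diag_EE_sum [X in _ + X]mxE addr0.
Qed.

Lemma triangular_diag2 (Q : rel 'I_N) :
  triangular_mx (fun x z => (Q x z)%:R) (\sum_i \sum_(j | Q i j) EE K i j j i).
Proof.
exists 0 => [|x y z t]; first exact: strict_mx0.
by rewrite diag_EE_sum2 [X in _ + X]mxE addr0.
Qed.

Let revE (x z : 'I_N) : (z == rev_ord x) = (x == rev_ord z).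
Proof. by rewrite -(inj_eq rev_ord_inj) rev_ordK eq_sym. Qed.

Lemma strict_low (F : 'I_N -> K) : strict_mx
  (\sum_(i < N | idx i <= n%:Z) F i *: EE K (rev_ord i) (rev_ord i) i i).
Proof.
have NE : (n.*2 <= N)%N by rewrite /dimN; case: ct.
apply: strict_mx_sum => i; rewrite /idx => iN; apply/strict_mxZ/strict_EE;
  by move: (ltn_ord i) NE iN; rewrite /=; lia.
Qed.

Lemma strict_gt : strict_mx
  (\sum_(i < N) \sum_(j < N | (j < i)%N && (j != rev_ord i)) EE K i i j j).
Proof.
apply: strict_mx_sum => i _; apply: strict_mx_sum => j /andP[ji _].
exact/strict_EE.
Qed.

Lemma strict_rev (F : 'I_N -> 'I_N -> K) : strict_mx
  (\sum_(i < N) \sum_(j < N | (i < j)%N && (j != rev_ord i))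
     F i j *: EE K (rev_ord i) j i (rev_ord j)).
Proof.
apply: strict_mx_sum => i _; apply: strict_mx_sum => j /andP[ij _].
by apply/strict_mxZ/strict_EE => //=; have := ltn_ord j; lia.
Qed.

Ltac triangular :=
  repeat first [apply: triangular_mxD | apply: triangular_diag
    | apply: triangular_diag2
    | apply: triangular_strict;
      first [exact: strict_gt | exact: strict_low | exact: strict_rev]
    | apply: triangular_mxZ].

(** In types C and D, [D x z] is [q^-1] for [z = x], [q] for [z = x'], and 1 otherwise. In type B
    the exponents double, and the value at the middle index paired with itself is 1. *)
Lemma Rhat_triangular : q != 0 ->
  exists D, [/\ triangular_mx D (Rhat q ct n), forall x z, D x z = D z x &
    forall x z, D x z != 0].
Proof.
move=> q0; have qX k : q ^ k != 0 by rewrite expfz_neq0.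
case: Rhat_cases => -[NE ->].
- have midE (x : 'I_N) : mid x = (x == rev_ord x).
    rewrite /mid /idx -val_eqE /=; have := ltn_ord x.
    by move: NE => /=; lia.
  (* [D] is assembled by unification from the contributions of the summands; the strict ones
     contribute 0. *)
  eexists; split; first by rewrite /Rhat_B; triangular.
  + move=> x z; rewrite /= !midE (eq_sym z x) (revE x z).
    have [->//|xz] := eqVneq x z; rewrite !andbF /=.
    by have [->|_] := eqVneq x (rev_ord z); rewrite ?rev_ordK ?(eq_sym z) ?andbF.
  + move=> x z; rewrite /= !midE !mulr0 !addr0.
    have [->|zx] := eqVneq z x; rewrite ?andbT ?andbF ?mulr0 ?addr0 ?add0r /=.
      have [_|_] := eqVneq x (rev_ord x);
        by rewrite /= ?mulr0 ?mulr1 ?addr0 ?add0r ?oner_neq0.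
    have [E|_] := eqVneq z (rev_ord x); rewrite ?andbT ?andbF ?mulr0 ?addr0 ?add0r /=.
      by rewrite -E (eq_sym x) zx mulr1.
    exact: oner_neq0.
- have revN (x : 'I_N) : x != rev_ord x.
    by rewrite -val_eqE /=; have := ltn_ord x; move: NE => /=; lia.
  eexists; split; first by rewrite /Rhat_CD; triangular.
  + by move=> x z; rewrite /= (eq_sym z x) (revE x z).
  + move=> x z; rewrite /= !mulr0 !addr0.
    have [->|zx] := eqVneq z x.
      by rewrite (negPf (revN x)) mulr0 !addr0 mulr1 invr_eq0.
    have [E|_] := eqVneq z (rev_ord x); first by rewrite mulr0 mulr1 add0r addr0.
    by rewrite !mulr0 !add0r oner_neq0.
Qed.
End RWeights.

(** * Twisting homomorphisms by degree *)

Section Twist.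
Variables (K : fieldType) (V : zmodType) (A B : pzAlgType K) (p p' : A -> B).
Variable Z : V -> B.
Hypotheses (pH : is_alg_hom p) (p'H : is_alg_hom p').
Hypotheses (Z0 : Z 0 = 1) (ZD : forall mu nu, Z (mu + nu) = Z mu * Z nu).
Hypothesis ZC : forall mu x, Z mu * p x = p x * Z mu.

(* The degree of x in the grading under which p' is the twist of p by Z; it need not be
   unique. *)
Definition homog (mu : V) (x : A) := p' x = p x * Z mu.

(** This is how homogeneity is used: a relation respected by [p] is respected by its twist when both
    sides have a common degree. *)
Lemma homog_rel mu x y : homog mu x -> homog mu y -> p x = p y -> p' x = p' y.
Proof. by move=> hx hy pxy; rewrite hx hy pxy. Qed.

Lemma homog0 mu : homog mu 0.
Proof. by rewrite /homog !alg_hom0 // mul0r. Qed.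

Lemma homog_scal k : homog 0 (scal k).
Proof. by rewrite /homog !alg_hom_scal // Z0 mulr1. Qed.

Lemma homog1 : homog 0 1.
Proof. by rewrite -(scal1 A); apply: homog_scal. Qed.

Lemma homogD mu x y : homog mu x -> homog mu y -> homog mu (x + y).
Proof. by move=> hx hy; rewrite /homog !alg_homD // hx hy mulrDl. Qed.

Lemma homogM mu nu x y : homog mu x -> homog nu y -> homog (mu + nu) (x * y).
Proof.
move=> hx hy; rewrite /homog !alg_homM // hx hy ZD.
by rewrite -!mulrA; congr (_ * _); rewrite !mulrA ZC.
Qed.

Lemma homogX mu x k : homog mu x -> homog (mu *+ k) (x ^+ k).
Proof.
move=> hx; elim: k => [|k IHk]; first by rewrite mulr0n expr0; apply: homog1.
by rewrite mulrS exprS; apply: homogM.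
Qed.

Lemma homog_sum mu I (r : seq I) (P : pred I) F :
  (forall i, P i -> homog mu (F i)) -> homog mu (\sum_(i <- r | P i) F i).
Proof.
by move=> hF; elim/big_ind: _ => //; [exact: homog0 | exact: homogD].
Qed.

Definition homog_mx m (al be : 'I_m -> V) (d : V) (M : 'M[A]_m) :=
  forall i j, homog (al i + be j + d) (M i j).

(** The weights of the contracted index cancel, so all terms of an entry have the same degree. *)
Lemma homog_mxM m (al be be' ga : 'I_m -> V) d d' (M P : 'M[A]_m) :
  (forall k, be' k = - be k) -> homog_mx al be d M -> homog_mx be' ga d' P ->
  homog_mx al ga (d + d') (M *m P).
Proof.
move=> bE hM hP i j; rewrite mxE; apply: homog_sum => k _.
have -> : al i + ga j + (d + d') = (al i + be k + d) + (- be k + ga j + d').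
  by rewrite [RHS]addrACA; congr (_ + _); rewrite addrA addrK.
by rewrite -bE; apply: homogM.
Qed.

(** At nonzero entries [w i - w j = 0], and zero is homogeneous of every degree. This sign
    convention fits a scalar matrix to the right of the [L] matrices in [LLR]; the opposite one fits
    the left in [RLL]. *)
Lemma homog_mx_scal m (w : 'I_m -> V) (M : 'M[K]_m) :
  graded_mx w M -> homog_mx w (\- w) 0 (scal_mx A M).
Proof.
move=> gM i j; rewrite mxE; have [->|/gM ->] := eqVneq (M i j) 0.
  by rewrite scal0; apply: homog0.
by rewrite subrr addr0; apply: homog_scal.
Qed.

Lemma homog_mx_scalN m (w : 'I_m -> V) (M : 'M[K]_m) :
  graded_mx w M -> homog_mx (\- w) w 0 (scal_mx A M).
Proof.
move=> gM i j; rewrite mxE /=; have [->|/gM ->] := eqVneq (M i j) 0.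
  by rewrite scal0; apply: homog0.
by rewrite addNr addr0; apply: homog_scal.
Qed.
End Twist.

(** * Homogeneity of the defining relations *)

Section Weights.
Variables (ct : classical_type) (n : nat).
Local Notation N := (dimN ct n).
Local Notation eps := (@epsilon ct n).

(* Lcoef pm e has the entries Ell pm i j (valuation pm e), or is 0 if valuation pm e < 0. *)
Definition valuation (pm : bool) (e : int) : int := if pm then e else - e.

(** These are the exponents prescribed by [eta]; those of the inverse generators are then forced. *)
Definition gen_deg (x : generator N) : 'rV[int]_n.+1 :=
  match x with
  | Gam _ s => if s then - wdelta n else wdelta n
  | Ell _ i j m => - eps i - eps j - wdelta n *+ (2 * m)
  | EllInv _ i => eps i + eps i
  end.

Lemma pair_wtE x z : @pair_wt ct n (mxtens_index (x, z)) = eps x + eps z.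
Proof. by rewrite /pair_wt mxtens_indexK. Qed.

Section FreeTwist.
Variables (K : fieldType) (R : nat -> 'M[K]_(N * N)).
Local Notation F := (free_alg K (generator N)).
Local Notation gen := (@fgen K (generator N)).
Variables (B : pzAlgType K) (p p' : F -> B) (Z : 'rV[int]_n.+1 -> B).
Hypotheses (pH : is_alg_hom p) (p'H : is_alg_hom p').
Hypotheses (Z0 : Z 0 = 1) (ZD : forall mu nu, Z (mu + nu) = Z mu * Z nu).
Hypothesis ZC : forall mu x, Z mu * p x = p x * Z mu.
Hypothesis p'gen : forall x, p' (gen x) = p (gen x) * Z (gen_deg x).
Hypothesis gR : forall k, graded_mx (@pair_wt ct n) (R k).
Local Notation hm := (homog p p' Z).
Local Notation hmx := (homog_mx p p' Z).
Local Notation w := (@pair_wt ct n).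

(* L1 and L2 are not homogeneous for the weights pair_wt on both sides: diff21 and
   diff12 grade the index contracted between them in RLL and LLR respectively. *)
Let diff21 (r : 'I_(N * N)) := eps (mxtens_unindex r).2 - eps (mxtens_unindex r).1.

Let diff21E x z : diff21 (mxtens_index (x, z)) = eps z - eps x.
Proof. by rewrite /diff21 mxtens_indexK. Qed.

Lemma homog_gen x : hm (gen_deg x) (gen x).
Proof. exact: p'gen. Qed.

(** For negative valuation the matrix is zero, which is homogeneous of every degree, so one formula
    covers all integers [e]. *)
Lemma homog_Lcoef pm e :
  hmx (\- eps) (\- eps) (- (wdelta n *~ (2 * valuation pm e))) (Lcoef K N pm e).
Proof.
move=> i j; rewrite /Lcoef; case: ifP => [ve|_]; last by rewrite mxE; apply: homog0.
rewrite mxE; have := homog_gen (Ell pm i j `|e|).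
suff -> : 2 * valuation pm e = (2 * `|e|)%N%:Z by [].
by rewrite /valuation; case: pm ve => ve; lia.
Qed.

(** In the entry at [(x, z)], [(y, z)] the degree of [l_xy] is split as
    [- (eps x + eps z) + (eps z - eps y)], and [z] cancels. The next three lemmas use similar
    splittings. *)
Lemma homog_RLL1 pm e :
  hmx (\- w) diff21 (- (wdelta n *~ (2 * valuation pm e))) (L1 K N pm e).
Proof.
move=> r s; case: (mxtens_indexP r) => x z; case: (mxtens_indexP s) => y t.
rewrite tensmxE /= pair_wtE diff21E.
rewrite [1%:M z t]mxE; have [->|_] := eqVneq z t; last first.
  by rewrite mulr0; apply: homog0.
rewrite mulr1 opprD addrA subrK; exact: homog_Lcoef.
Qed.

Lemma homog_RLL2 pm e :
  hmx (\- diff21) (\- w) (- (wdelta n *~ (2 * valuation pm e))) (L2 K N pm e).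
Proof.
move=> r s; case: (mxtens_indexP r) => x z; case: (mxtens_indexP s) => y t.
rewrite tensmxE /= pair_wtE diff21E.
rewrite [1%:M x y]mxE; have [->|_] := eqVneq x y; last first.
  by rewrite mul0r; apply: homog0.
rewrite mul1r opprB opprD addrA [eps y - _ - _]addrAC subrr sub0r.
exact: homog_Lcoef.
Qed.

Let diff12 (r : 'I_(N * N)) := eps (mxtens_unindex r).1 - eps (mxtens_unindex r).2.
Let diff12E x z : diff12 (mxtens_index (x, z)) = eps x - eps z.
Proof. by rewrite /diff12 mxtens_indexK. Qed.

Lemma homog_LLR1 pm e :
  hmx (\- diff12) (\- w) (- (wdelta n *~ (2 * valuation pm e))) (L1 K N pm e).
Proof.
move=> r s; case: (mxtens_indexP r) => x z; case: (mxtens_indexP s) => y t.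
rewrite tensmxE /= pair_wtE diff12E.
rewrite [1%:M z t]mxE; have [->|_] := eqVneq z t; last first.
  by rewrite mulr0; apply: homog0.
rewrite mulr1 opprB opprD [eps t - _]addrC addrACA subrr addr0; exact: homog_Lcoef.
Qed.

Lemma homog_LLR2 pm e :
  hmx (\- w) diff12 (- (wdelta n *~ (2 * valuation pm e))) (L2 K N pm e).
Proof.
move=> r s; case: (mxtens_indexP r) => x z; case: (mxtens_indexP s) => y t.
rewrite tensmxE /= pair_wtE diff12E.
rewrite [1%:M x y]mxE; have [->|_] := eqVneq x y; last first.
  by rewrite mul0r; apply: homog0.
rewrite mul1r opprD addrA [- eps y - _ + _]addrAC addNr sub0r; exact: homog_Lcoef.
Qed.

Section RLL.
Variables (u : F) (nu d : 'rV[int]_n.+1) (pm pm' : bool) (a b : int).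
Hypothesis hu : hm nu u.
Hypothesis dE : forall k : nat, nu *+ k - wdelta n *~ (2 * valuation pm (a - k%:Z))
    - wdelta n *~ (2 * valuation pm' (b + k%:Z)) = d.

(** By [dE] the degree of [u ^+ k] compensates the change of the two exponents with [k], so all
    summands have the same degree. *)
Lemma homog_RLL r c : hm (- w r - w c + d) (RLL R u pm pm' a b r c).
Proof.
rewrite /RLL summxE; apply: homog_sum => // k _; rewrite mxE.
have hX := homogX pH p'H Z0 ZD ZC k hu.
have hM := homog_mxM pH p'H ZD ZC (fun=> erefl)
  (homog_mxM pH p'H ZD ZC (fun=> erefl) (homog_mx_scalN pH p'H Z0 (@gR k))
     (homog_RLL1 pm (a - k%:Z))) (homog_RLL2 pm' (b + k%:Z)).
have := homogM pH p'H ZD ZC hX (hM r c); congr homog.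
by rewrite -(dE k) addrCA add0r !addrA.
Qed.

Lemma homog_LLR r c : hm (- w r - w c + d) (LLR R u pm pm' a b r c).
Proof.
rewrite /LLR summxE; apply: homog_sum => // k _; rewrite mxE.
have hX := homogX pH p'H Z0 ZD ZC k hu.
have hM := homog_mxM pH p'H ZD ZC (fun=> esym (opprK _))
  (homog_mxM pH p'H ZD ZC (fun=> erefl) (homog_LLR2 pm' (b + k%:Z))
     (homog_LLR1 pm (a - k%:Z)))
  (homog_mx_scal pH p'H Z0 (@gR k)).
have := homogM pH p'H ZD ZC hX (hM r c); congr homog.
by rewrite -(dE k) addrCA addr0 [X in _ + (_ + X)]addrC !addrA.
Qed.
End RLL.

Lemma homog_shift b : hm (wdelta n *~ (- 4)) (shift K N b).
Proof.
have -> : wdelta n *~ (- 4) = - wdelta n *+ 2 + (- wdelta n + - wdelta n).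
  by rewrite mulrNz -pmulrn -mulNrn !mulrS !mulr0n !addr0 !addrA.
apply: (homogM pH p'H ZD ZC); first exact: (homogX _ _ _ _ _ _ (homog_gen (Gam b true))).
exact: (homogM pH p'H ZD ZC (homog_gen (Gam false true)) (homog_gen (Gam true true))).
Qed.

Lemma homog_U_rel x y : U_rel R x y -> exists2 mu, hm mu x & hm mu y.
Proof.
have h0 mu : hm mu 0 := homog0 Z pH p'H mu.
have h1 : hm 0 1 := homog1 pH p'H Z0.
have hM := homogM pH p'H ZD ZC.
case=> [b|b s t|i j _|i j _|pm i|pm i|pm a b r c|a b r c].
- exists 0 => //; have := hM _ _ _ _ (homog_gen (Gam b true)) (homog_gen (Gam b false)).
  by rewrite addNr.
- exists (gen_deg (Gam b s) + gen_deg t); last rewrite addrC;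
    exact: hM (homog_gen _) (homog_gen _).
- by eexists; [exact: homog_gen | exact: h0].
- by eexists; [exact: homog_gen | exact: h0].
- exists 0 => //; have := hM _ _ _ _ (homog_gen (Ell pm i i 0)) (homog_gen (EllInv pm i)).
  by rewrite /= mulr0n subr0 addrA subrK addNr.
- exists 0 => //; have := hM _ _ _ _ (homog_gen (EllInv pm i)) (homog_gen (Ell pm i i 0)).
  by rewrite /= mulr0n subr0 addrA addrK subrr.
- pose d := - (wdelta n *~ (2 * (valuation pm a + valuation pm b))).
  exists (- w r - w c + d); [apply: (homog_RLL h1) | apply: (homog_LLR h1)];
    move=> k; rewrite /d mul0rn sub0r -opprD -mulrzDr; congr (- (_ *~ _));
    by rewrite /valuation; case: pm {d}; lia.
(* In the mixed case the valuations add up to [a - b - 2k]. The resulting [4k delta] is cancelled by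
   the degree [-4 delta] of each factor [shift]. *)
- pose d := - (wdelta n *~ (2 * (a - b))).
  exists (- w r - w c + d);
    [apply: (homog_RLL (homog_shift _)) | apply: (homog_LLR (homog_shift _))];
    move=> k; rewrite /d pmulrn -mulrzA -!mulrNz -!mulrzDr; congr (_ *~ _);
    by rewrite /valuation; lia.
Qed.
End FreeTwist.
End Weights.

Section TwistUt.
Variables (K : fieldType) (q : K) (ct : classical_type) (n : nat) (f : nat -> K).
Local Notation N := (dimN ct n).
Local Notation eps := (@epsilon ct n).
Local Notation U := (algU (Rtilde q ct n f)).
Local Notation Ut := (algUt q ct n f).
Local Notation genU := (genU (Rtilde q ct n f)).
Variables (B : pzAlgType K) (Z : 'rV[int]_n.+1 -> B).
Hypotheses (Z0 : Z 0 = 1) (ZD : forall mu nu, Z (mu + nu) = Z mu * Z nu).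

(** This makes the type B relation [l_(n+1,n+1)[0] = 1] homogeneous of degree 0. *)
Lemma epsilon_mid (i : 'I_N) : ct = TypeB -> mid i -> eps i = 0.
Proof.
move=> cB; have NE : N = n.*2.+1 by rewrite /dimN cB.
rewrite /mid /idx /epsilon => /eqP Ei.
have -> : (i < n)%N = false by lia.
by have -> : (rev_ord i < n)%N = false by move: NE => /=; lia.
Qed.

Lemma graded_Cq (V : eqType) (w : 'I_N -> V) : graded_mx w (Cq q ct n).
Proof.
by move=> i j; rewrite mxE; have [->|_] := eqVneq i j; rewrite ?eqxx.
Qed.

Section QuotTwist.
Variables (p p' : U -> B).
Hypotheses (pH : is_alg_hom p) (p'H : is_alg_hom p').
Hypothesis ZC : forall mu x, Z mu * p x = p x * Z mu.
Hypothesis p'gen : forall x, p' (genU x) = p (genU x) * Z (gen_deg x).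
Local Notation hm := (homog p p' Z).
Local Notation hmx := (homog_mx p p' Z).

Lemma homog_Lmat pm m :
  hmx (\- eps) (\- eps) (- (wdelta n *+ (2 * m))) (@Lmat K q ct n f pm m).
Proof. by move=> i j; rewrite mxE; exact: (p'gen (Ell pm i j m)). Qed.

(** Replacing an index by [i'] negates its weight, which is what contraction with [Lmat]
    requires. *)
Lemma homog_transp' M d : hmx (\- eps) (\- eps) d M -> hmx eps eps d (@transp' ct n U M).
Proof.
move=> hM i j; rewrite mxE; have := hM (rev_ord j) (rev_ord i).
by rewrite /= !epsilon_rev !opprK addrC [eps j + _]addrC addrC.
Qed.

(** The degree is 0 when [m = 0] and [i = j], where the relation has right-hand side 1; at all other
    entries the right-hand side is 0. *)
Lemma homog_LCLC pm m i j :
  hm (- eps i + eps j - wdelta n *+ (2 * m)) (@LCLC K q ct n f pm m i j).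
Proof.
rewrite /LCLC summxE; apply: homog_sum => // k _; rewrite mxE.
have MM := homog_mxM pH p'H ZD ZC.
have hS M := homog_mx_scal pH p'H Z0 (M := M) (w := eps).
have hSN M := homog_mx_scalN pH p'H Z0 (M := M) (w := eps).
have h1 := MM _ _ _ _ _ _ _ _ _ (fun=> esym (opprK _)) (homog_Lmat pm k)
  (hS _ (graded_Cq _)).
have h2 := MM _ _ _ _ _ _ _ _ _ (fun=> esym (opprK _)) h1
  (homog_transp' (homog_Lmat pm (m - k))).
have h3 := MM _ _ _ _ _ _ _ _ _ (fun=> erefl) h2 (hSN _ (graded_invmx (graded_Cq _))).
have := homogM pH p'H ZD ZC (homog_scal pH p'H Z0 (parxi q ct n ^ _)) (h3 i j).
move=> /(_ (if pm then (m - k)%N%:Z else - (m - k)%N%:Z)); congr homog.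
rewrite add0r !addr0; congr (_ + _).
by rewrite -opprD -mulrnDr -mulnDr subnKC // -ltnS.
Qed.

Lemma homog_Ut_rel x y : Ut_rel x y -> exists2 mu, hm mu x & hm mu y.
Proof.
have h0 mu : hm mu 0 := homog0 Z pH p'H mu.
have h1 : hm 0 1 := homog1 pH p'H Z0.
case=> [pm m i j|pm i cB mi]; eexists; try exact: homog_LCLC.
- have [->|_] := eqVneq m 0%N; last exact: h0.
  have [->|_] := eqVneq i j; last exact: h0.
  by rewrite addNr muln0 mulr0n subr0; exact: h1.
- exact: (p'gen (Ell pm i i 0)).
- by rewrite /gen_deg epsilon_mid // muln0 mulr0n !subr0 oppr0; exact: h1.
Qed.
End QuotTwist.

(* All relations are homogeneous, so multiplying each generator by Z at its degree
   respects them. *)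
Lemma twist_hom (h : Ut -> B) : is_alg_hom h ->
  (forall mu x, Z mu * h x = h x * Z mu) ->
  exists2 h' : Ut -> B, is_alg_hom h' &
    forall x, h' (genUt q f x) = h (genUt q f x) * Z (gen_deg x).
Proof.
move=> hh ZC; pose p1 : U -> B := h \o qpi (@Ut_rel K q ct n f).
have p1H : is_alg_hom p1 := alg_hom_comp hh (qpi_hom _).
have p1rel x y : Ut_rel x y -> p1 x = p1 y by move=> r; rewrite /p1 /= (qpi_rel r).
pose p0 : free_alg K (generator N) -> B := p1 \o qpi (@U_rel K N (Rtilde q ct n f)).
have p0H : is_alg_hom p0 := alg_hom_comp p1H (qpi_hom _).
have p0rel x y : U_rel (Rtilde q ct n f) x y -> p0 x = p0 y.
  by move=> r; rewrite /p0 /= (qpi_rel r).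
(* The twist is defined on the free algebra and descends through the two quotients in turn. *)
have [p0' p0'H p0'E] := free_hom_exists (fun x => p0 (fgen K x) * Z (gen_deg x)).
have [x y r|p1' p1'H p1'E] := quot_hom_exists (rel := @U_rel K N (Rtilde q ct n f)) p0'H.
  have [mu hx hy] := homog_U_rel p0H p0'H Z0 ZD (fun mu x => ZC mu _) p0'E
    (@graded_Rtilde K q ct n f) r.
  exact: homog_rel hx hy (p0rel _ _ r).
have [x y r|h' h'H h'E] := quot_hom_exists (rel := @Ut_rel K q ct n f) p1'H.
  have [|mu hx hy] := homog_Ut_rel p1H p1'H (fun mu x => ZC mu _) _ r.
    by move=> g; rewrite /genU p1'E p0'E.
  exact: homog_rel hx hy (p1rel _ _ r).
by exists h' => // x; rewrite h'E p1'E p0'E.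
Qed.
End TwistUt.

(** * Central elements *)

Section TensorEntries.
Variables (A : pzRingType) (N : nat).
Implicit Types (X Y : 'M[A]_N) (S : 'M[A]_(N * N)).

Lemma sum_mxtens (F : 'I_(N * N) -> A) :
  \sum_k F k = \sum_i \sum_j F (mxtens_index (i, j)).
Proof.
rewrite pair_bigA (reindex (@mxtens_index N N)) /=; first by apply: eq_bigr => -[].
by exists (@mxtens_unindex N N) => k _; [apply: mxtens_indexK | apply: mxtens_unindexK].
Qed.

(** The entries of [X] and [Y] need not commute; the order of the two factors is all that
    distinguishes this from [tens_YX]. *)
Lemma tens_XY X Y x z y t :
  ((X *t 1%:M) *m (1%:M *t Y)) (mxtens_index (x, z)) (mxtens_index (y, t)) = X x y * Y z t.
Proof.
rewrite mxE sum_mxtens (bigD1 y) //= [X in _ + X]big1 => [|i iy]; last first.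
  by apply: big1 => j _; rewrite !tensmxE [1%:M i y]mxE (negPf iy) mul0r mulr0.
rewrite addr0 (bigD1 z) //= big1 => [|j jz]; last first.
  by rewrite !tensmxE [1%:M z j]mxE eq_sym (negPf jz) mulr0 mul0r.
by rewrite !tensmxE !mxE !eqxx mulr1 mul1r addr0.
Qed.

Lemma tens_YX X Y x z y t :
  ((1%:M *t Y) *m (X *t 1%:M)) (mxtens_index (x, z)) (mxtens_index (y, t)) = Y z t * X x y.
Proof.
rewrite mxE sum_mxtens (bigD1 x) //= [X in _ + X]big1 => [|i ix]; last first.
  by apply: big1 => j _; rewrite !tensmxE [1%:M x i]mxE eq_sym (negPf ix) !mul0r.
rewrite addr0 (bigD1 t) //= big1 => [|j jt]; last first.
  by rewrite !tensmxE [1%:M j t]mxE (negPf jt) !mulr0.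
by rewrite !tensmxE !mxE !eqxx mulr1 mul1r addr0.
Qed.
End TensorEntries.

(** * Commutation relations from the constant term of the R-matrix *)

Section Exchange.
Variables (K : fieldType) (q : K) (ct : classical_type) (n : nat).
Local Notation N := (dimN ct n).
Variables (D : 'I_N -> 'I_N -> K) (M : 'M[K]_(N * N)) (kappa : K).
Hypotheses (DM : triangular_mx D M) (k0 : kappa != 0).
Variables (A : pzAlgType K) (X Y : 'M[A]_N).
Let S : 'M[A]_(N * N) := scal_mx A (kappa *: (M *m flip K ct n)).
Hypothesis SXY : S *m (X *t 1%:M) *m (1%:M *t Y) = (1%:M *t Y) *m (X *t 1%:M) *m S.

Lemma flip_entry (i j y t : 'I_N) :
  flip K ct n (mxtens_index (i, j)) (mxtens_index (y, t)) = ((j == y) && (i == t))%:R.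
Proof. by rewrite (diag_EE_sum2 K (fun _ _ => true)) mulr1 eq_sym [y == j]eq_sym andbC. Qed.

Lemma mul_flip_entry (x z y t : 'I_N) :
  (M *m flip K ct n) (mxtens_index (x, z)) (mxtens_index (y, t)) =
  M (mxtens_index (x, z)) (mxtens_index (t, y)).
Proof.
rewrite mxE sum_mxtens (bigD1 t) //= [X in _ + X]big1 => [|i it]; last first.
  by apply: big1 => j _; rewrite flip_entry (negPf it) andbF mulr0.
rewrite addr0 (bigD1 y) //= big1 => [|j jy]; last first.
  by rewrite flip_entry (negPf jy) mulr0.
by rewrite flip_entry !eqxx mulr1 addr0.
Qed.

Let SE r s : S r s = scal (kappa * (M *m flip K ct n) r s).
Proof. by rewrite mxE [X in scal X]mxE. Qed.

Let S_diag x z : S (mxtens_index (x, z)) (mxtens_index (x, z)) = scal (kappa * D x z).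
Proof.
case: DM => T sT ME; rewrite SE mul_flip_entry ME !eqxx mul1r.
have [->|/sT] := eqVneq (T (mxtens_index (x, z)) (mxtens_index (z, x))) 0.
  by rewrite addr0.
by rewrite ltnn.
Qed.

Let S_off x z y t : S (mxtens_index (x, z)) (mxtens_index (y, t)) != 0 ->
  ((y == x) && (t == z)) || ((y < x)%N && (z < t)%N).
Proof.
case: DM => T sT ME; rewrite SE mul_flip_entry ME.
have [//|yx] := boolP (_ && _); rewrite mul0r add0r.
have [->|/sT //] := eqVneq (T (mxtens_index (x, z)) (mxtens_index (t, y))) 0.
by rewrite mulr0 scal0 eqxx.
Qed.

Let sum1 (F : 'I_N -> 'I_N -> A) a c :
  (forall i j, F i j != 0 -> (i == a) && (j == c)) -> \sum_i \sum_j F i j = F a c.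
Proof.
move=> F0; rewrite (bigD1 a) //= [X in _ + X]big1 => [|i ia]; last first.
  by apply: big1 => j _; apply: contraNeq ia => /F0/andP[].
by rewrite addr0 (bigD1 c) //= big1 ?addr0 // => j; apply: contraNeq => /F0/andP[].
Qed.

Let mxE_XY x z y t : \sum_i \sum_j S (mxtens_index (x, z)) (mxtens_index (i, j))
    * (X i y * Y j t) =
  \sum_i \sum_j Y z j * X x i * S (mxtens_index (i, j)) (mxtens_index (y, t)).
Proof.
have := congr1 (fun P : 'M_(N * N) => P (mxtens_index (x, z)) (mxtens_index (y, t))) SXY.
rewrite -mulmxA mxE sum_mxtens [X in _ = X -> _]mxE sum_mxtens.
under eq_bigr do under eq_bigr do rewrite tens_XY.
by under [X in _ = X -> _]eq_bigr do under eq_bigr do rewrite tens_YX.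
Qed.

(* In the entry ((a, c), (a, d)) of the exchange relation every strict term meets a
   vanishing entry of X, so that only the diagonal D survives; exchange_upper does
   the same with Y and the entry ((a, c), (b, c)). *)
Lemma exchange_lower a c d : (forall i j : 'I_N, (i < j)%N -> X i j = 0) ->
  scal (D a c) * (X a a * Y c d) = scal (D a d) * (Y c d * X a a).
Proof.
move=> X0; have := mxE_XY a c a d.
rewrite (sum1 (a := a) (c := c)) => [|i j nz]; last first.
  have [ia|ia] := boolP (i < a)%N; first by rewrite X0 ?mul0r ?mulr0 ?eqxx in nz.
  have /S_off : S (mxtens_index (a, c)) (mxtens_index (i, j)) != 0.
    by apply: contraNneq nz => ->; rewrite mul0r.
  by rewrite (negPf ia) orbF.
rewrite (sum1 (a := a) (c := d)) => [|i j nz]; last first.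
  have [ai|ai] := boolP (a < i)%N; first by rewrite X0 ?mulr0 ?mul0r ?eqxx in nz.
  have /S_off : S (mxtens_index (i, j)) (mxtens_index (a, d)) != 0.
    by apply: contraNneq nz => ->; rewrite mulr0.
  by rewrite (negPf ai) orbF eq_sym [d == _]eq_sym.
by rewrite !S_diag -scal_central !scalM -!mulrA => /(scalI k0).
Qed.

Lemma exchange_upper a b c : (forall i j : 'I_N, (j < i)%N -> Y i j = 0) ->
  scal (D a c) * (X a b * Y c c) = scal (D b c) * (Y c c * X a b).
Proof.
move=> Y0; have := mxE_XY a c b c.
rewrite (sum1 (a := a) (c := c)) => [|i j nz]; last first.
  have [cj|cj] := boolP (c < j)%N; first by rewrite Y0 ?mulr0 ?mulr0 ?eqxx in nz.
  have /S_off : S (mxtens_index (a, c)) (mxtens_index (i, j)) != 0.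
    by apply: contraNneq nz => ->; rewrite mul0r.
  by rewrite (negPf cj) andbF orbF.
rewrite (sum1 (a := b) (c := c)) => [|i j nz]; last first.
  have [jc|jc] := boolP (j < c)%N; first by rewrite Y0 ?mul0r ?eqxx in nz.
  have /S_off : S (mxtens_index (i, j)) (mxtens_index (b, c)) != 0.
    by apply: contraNneq nz => ->; rewrite mulr0.
  by rewrite (negPf jc) andbF orbF eq_sym [c == _]eq_sym.
by rewrite !S_diag -scal_central !scalM -!mulrA => /(scalI k0).
Qed.
End Exchange.

Section MapMx.
Variables (K : fieldType) (A B : pzAlgType K) (p : A -> B).
Hypothesis pH : is_alg_hom p.

Lemma alg_hom_mulmx m k l (M : 'M[A]_(m, k)) (P : 'M[A]_(k, l)) :
  map_mx p (M *m P) = map_mx p M *m map_mx p P.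
Proof.
apply/matrixP => i j; rewrite !mxE alg_hom_sum //; apply: eq_bigr => t _.
by rewrite alg_homM // !mxE.
Qed.

Lemma alg_hom_tensmx m k l r (M : 'M[A]_(m, k)) (P : 'M[A]_(l, r)) :
  map_mx p (M *t P) = map_mx p M *t map_mx p P.
Proof. by apply/matrixP => i j; rewrite !mxE alg_homM. Qed.

Lemma alg_hom_mx1 m : map_mx p (1%:M : 'M[A]_m) = 1%:M.
Proof.
by apply/matrixP => i j; rewrite !mxE; case: eqP => _; rewrite ?alg_hom1 ?alg_hom0.
Qed.

Lemma alg_hom_scal_mx m k (M : 'M[K]_(m, k)) : map_mx p (scal_mx A M) = scal_mx B M.
Proof. by apply/matrixP => i j; rewrite !mxE alg_hom_scal. Qed.
End MapMx.

Section Constant.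
Variables (K : fieldType) (N : nat) (R : nat -> 'M[K]_(N * N)).
Local Notation F := (free_alg K (generator N)).
Variables (B : pzAlgType K) (p : F -> B).
Hypothesis pH : is_alg_hom p.
Let Lp pm e := map_mx p (Lcoef K N pm e).

(* For these exponents only the summand with R 0 survives in the relations. *)
Definition constant_case (pm pm' : bool) (a b : int) :=
  (pm && (a == 0)) || (~~ pm' && (b == 0)).

(** The surviving summand carries [u ^+ 0 = 1], so the mixed relation takes the same form as the
    others, free of [gamma]. *)
Lemma RLL_constant u pm pm' a b : constant_case pm pm' a b ->
  map_mx p (RLL R u pm pm' a b) =
    scal_mx B (R 0) *m (Lp pm a *t 1%:M) *m (1%:M *t Lp pm' b) /\
  map_mx p (LLR R u pm pm' a b) =
    (1%:M *t Lp pm' b) *m (Lp pm a *t 1%:M) *m scal_mx B (R 0).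
Proof.
move=> ab.
(* The exponent [a - k - 1] is negative for the sign + and [a = 0], and [b + k + 1] is positive for
   the sign - and [b = 0]. *)
have L0 (k : nat) : L1 K N pm (a - k.+1%:Z) = 0 \/ L2 K N pm' (b + k.+1%:Z) = 0.
  case/orP: ab => /andP[]; [move=> pT /eqP -> | move=> pF /eqP ->]; [left | right].
    by rewrite /L1 /Lcoef pT tens0mx.
  by rewrite /L2 /Lcoef (negPf pF) tensmx0.
have EL1 : map_mx p (L1 K N pm a) = Lp pm a *t 1%:M.
  by rewrite /L1 (alg_hom_tensmx pH) (alg_hom_mx1 pH).
have EL2 : map_mx p (L2 K N pm' b) = 1%:M *t Lp pm' b.
  by rewrite /L2 (alg_hom_tensmx pH) (alg_hom_mx1 pH).
split; rewrite /RLL /LLR big_ord_recl big1 ?addr0 => [|k _];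
  try by case: (L0 k); rewrite /= /bump /= add1n => ->;
         rewrite ?mulmx0 ?mul0mx ?mulmx0 scaler0.
all: rewrite /= expr0 scale1r ?subr0 ?addr0.
all: rewrite (alg_hom_mulmx pH) (alg_hom_mulmx pH).
- exact: (f_equal2 mulmx (f_equal2 mulmx (alg_hom_scal_mx pH (R 0)) EL1) EL2).
- exact: (f_equal2 mulmx (f_equal2 mulmx EL2 EL1) (alg_hom_scal_mx pH (R 0))).
Qed.
End Constant.

Section CentralElements.
Variables (K : fieldType) (q : K) (ct : classical_type) (n : nat) (f : nat -> K).
Local Notation N := (dimN ct n).
Local Notation R := (Rtilde q ct n f).
Local Notation F := (free_alg K (generator N)).
Local Notation gen := (@fgen K (generator N)).
Hypotheses (q0 : q != 0) (f0 : f 0%N = 1).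
Variables (B : pzAlgType K) (p : F -> B).
Hypothesis pH : is_alg_hom p.
Hypothesis prel : forall x y, U_rel R x y -> p x = p y.
Let l pm i j m : B := p (gen (Ell pm i j m)).
Let X pm m : 'M[B]_N := \matrix_(i, j) l pm i j m.
Let expo (pm : bool) (m : nat) : int := if pm then m%:Z else - m%:Z.

Let XE pm m : map_mx p (Lcoef K N pm (expo pm m)) = X pm m.
Proof.
apply/matrixP => i j; rewrite !mxE /Lcoef.
have -> : (if pm then 0 <= expo pm m else expo pm m <= 0) by rewrite /expo; case: pm; lia.
by rewrite mxE; have -> : `|expo pm m|%N = m by rewrite /expo; case: pm; lia.
Qed.

(** The condition [pm || ~~ pm'] excludes the pair of signs (-, +), for which no relation is
    imposed. *)
Let constant_rel pm pm' a b :
  pm || ~~ pm' -> constant_case pm pm' (expo pm a) (expo pm' b) ->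
  scal_mx B (R 0) *m (X pm a *t 1%:M) *m (1%:M *t X pm' b) =
  (1%:M *t X pm' b) *m (X pm a *t 1%:M) *m scal_mx B (R 0).
Proof.
move=> pmpm' ab; rewrite -!XE.
have RL u u' : (forall r c, U_rel R (RLL R u pm pm' (expo pm a) (expo pm' b) r c)
                                (LLR R u' pm pm' (expo pm a) (expo pm' b) r c)) ->
    map_mx p (RLL R u pm pm' (expo pm a) (expo pm' b)) =
    map_mx p (LLR R u' pm pm' (expo pm a) (expo pm' b)).
  move=> ur; apply/matrixP => r c.
  by rewrite [LHS]mxE [RHS]mxE; exact: prel (ur r c).
case: pm pm' pmpm' ab RL => -[] // _ ab RL.
- have [<- _] := RLL_constant R pH 1 ab; have [_ <-] := RLL_constant R pH 1 ab.
  by apply: RL => r c; apply: U_RLL.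
- have [<- _] := RLL_constant R pH (shift K N false) ab.
  have [_ <-] := RLL_constant R pH (shift K N true) ab.
  by apply: RL => r c; apply: U_RLL_mixed.
- have [<- _] := RLL_constant R pH 1 ab; have [_ <-] := RLL_constant R pH 1 ab.
  by apply: RL => r c; apply: U_RLL.
Qed.

Definition zeta (i : 'I_N) : B := l true i i 0 * l false i i 0.

(** The matrix of the [l^+[0]] is lower triangular and takes the place of [X]; that of the [l^-[0]]
    is upper triangular and takes the place of [Y]. The other place is open to either sign and every
    [m]. *)
Let exchanges : exists2 D : 'I_N -> 'I_N -> K,
  (forall x z, D x z = D z x) /\ (forall x z, D x z != 0)
  & forall a pm c d m,
    scal (D a c) * (l true a a 0 * l pm c d m) =
      scal (D a d) * (l pm c d m * l true a a 0) /\
    scal (D c a) * (l pm c d m * l false a a 0) =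
      scal (D d a) * (l false a a 0 * l pm c d m).
Proof.
have [D [DM Dsym D0]] := Rhat_triangular ct n q0.
have k0 : parxi q ct n * parv q ct != 0.
  by rewrite mulf_neq0 // /parxi /parv; case: ct; rewrite ?expfz_neq0 ?invr_eq0.
exists D; [by [] | move=> a pm c d m; split].
- have := constant_rel (pm := true) (pm' := pm) (a := 0) (b := m) isT.
  rewrite /constant_case /= (Rtilde0 q ct n f0) => /(_ isT) rel.
  have := exchange_lower DM k0 rel a c d; rewrite !mxE; apply=> i j ij.
  by rewrite mxE /l (prel (U_tri_plus R ij)) alg_hom0.
- have := constant_rel (pm := pm) (pm' := false) (a := m) (b := 0).
  rewrite /constant_case /= oppr0 eqxx !orbT (Rtilde0 q ct n f0) => /(_ isT isT) rel.
  have := exchange_upper DM k0 rel c d a; rewrite !mxE; apply=> i j ij.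
  by rewrite mxE /l (prel (U_tri_minus R ij)) alg_hom0.
Qed.

(** With all indices equal, both sides of the exchange relation carry the same scalar [D i i]. *)
Lemma diag_comm i : l true i i 0 * l false i i 0 = l false i i 0 * l true i i 0.
Proof.
have [D [_ D0] ex] := exchanges.
by apply: (scalI (D0 i i)); have [] := ex i false i i 0%N.
Qed.

(* The scalars picked up by the two factors of zeta a are inverse, as D is symmetric. *)
Let zeta_comm_Ell a pm c d m : l pm c d m * zeta a = zeta a * l pm c d m.
Proof.
have [D [Dsym D0] ex] := exchanges; have [eA eB] := ex a pm c d m.
rewrite /zeta; set x := l true a a 0 in eA *; set y := l false a a 0 in eB *.
set z := l pm c d m in eA eB *; apply/esym/(scalI (D0 d a)).
have -> : scal (D d a) * (x * y * z) = x * (scal (D d a) * (y * z)).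
  by rewrite !mulrA scal_central.
rewrite -eB mulrA -scal_central -mulrA [x * (z * y)]mulrA mulrA.
by rewrite Dsym eA -!mulrA Dsym.
Qed.

Let comm_inv (x y z : B) : x * y = 1 -> y * x = 1 -> x * z = z * x -> y * z = z * y.
Proof.
move=> xy yx xz; rewrite -[y * z]mulr1 -xy mulrA -[y * z * x]mulrA -xz mulrA yx mul1r.
by [].
Qed.

Lemma Gam_comm b s x : p x * p (gen (Gam b s)) = p (gen (Gam b s)) * p x.
Proof.
apply: (free_comm pH) => t.
rewrite -[LHS](alg_homM pH) -[RHS](alg_homM pH).
exact/esym/prel/U_gam_central.
Qed.

Lemma Ell_invr pm i : p (gen (Ell pm i i 0)) * p (gen (EllInv pm i)) = 1.
Proof. rewrite -[LHS](alg_homM pH) (prel (U_invr R pm i)); exact: alg_hom1 pH. Qed.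

Lemma Ell_invl pm i : p (gen (EllInv pm i)) * p (gen (Ell pm i i 0)) = 1.
Proof. rewrite -[LHS](alg_homM pH) (prel (U_invl R pm i)); exact: alg_hom1 pH. Qed.

Lemma zeta_comm i x : p x * zeta i = zeta i * p x.
Proof.
apply: (free_comm pH) => -[b s|pm a b m|pm a]; last 1 first.
- exact: comm_inv (Ell_invr pm a) (Ell_invl pm a) (zeta_comm_Ell i pm a a 0).
- by rewrite /zeta /l -(alg_homM pH); exact/esym/Gam_comm.
- exact: zeta_comm_Ell.
Qed.
End CentralElements.

(** * Consequences of the relation with [Cq] *)

Section Unitarity.
Variables (K : fieldType) (q : K) (ct : classical_type) (n : nat) (f : nat -> K).
Local Notation N := (dimN ct n).
Local Notation R := (Rtilde q ct n f).
Local Notation U := (algU R).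
Local Notation Ut := (algUt q ct n f).
Local Notation genU := (genU R).
Local Notation genUt := (@genUt K q ct n f).
Local Notation F := (free_alg K (generator N)).
Local Notation gen := (@fgen K (generator N)).
Hypotheses (q0 : q != 0) (f0 : f 0%N = 1).

Lemma Cq_unit : Cq q ct n \in unitmx.
Proof.
rewrite unitmxE det_diag unitfE; apply/prodf_neq0 => i _; rewrite mxE mulf_neq0 //.
  by rewrite /crho_sign; case: ct i => i; try case: ifP => _; rewrite ?oppr_eq0 oner_eq0.
by rewrite expfz_neq0.
Qed.

Lemma Cq_conj_diag i : Cq q ct n i i * invmx (Cq q ct n) i i = 1.
Proof.
have gC : graded_mx id (Cq q ct n) := graded_Cq _.
transitivity ((Cq q ct n *m invmx (Cq q ct n)) i i); last first.
  by rewrite (mulmxV Cq_unit) mxE eqxx.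
rewrite [RHS]mxE (bigD1 i) //= [X in _ = _ + X]big1 ?addr0 // => j ji.
have [->|/gC /eqP] := eqVneq (Cq q ct n i j) 0; first by rewrite mul0r.
by rewrite eq_sym (negPf ji).
Qed.

(** The entry is the sum over [s] of [X_is c_s X_i's' c_i^-1]; only [s = i] survives, and there the
    [c_i] cancel. *)
Lemma LCLC_entry (A : pzAlgType K) (X : 'M[A]_N) i :
  (forall s, s != i -> X i s = 0 \/ X (rev_ord i) (rev_ord s) = 0) ->
  (X *m scal_mx A (Cq q ct n) *m transp' X *m scal_mx A (invmx (Cq q ct n))) i i =
  X i i * X (rev_ord i) (rev_ord i).
Proof.
move=> X0.
have gC : graded_mx id (Cq q ct n) := graded_Cq _.
have CE (M : 'M[K]_N) (Y : 'M[A]_N) r s : graded_mx id M ->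
    (Y *m scal_mx A M) r s = Y r s * scal (M s s).
  move=> gM; rewrite mxE (bigD1 s) //= mxE big1 ?addr0 // => t ts.
  rewrite mxE; have [->|/gM /eqP] := eqVneq (M t s) 0; first by rewrite scal0 mulr0.
  by rewrite (negPf ts).
rewrite CE; last exact: graded_invmx.
rewrite mxE (bigD1 i) //= big1 ?addr0 => [|s si]; last first.
  by rewrite CE // [transp' X s i]mxE; case: (X0 s si) => ->; rewrite ?mul0r ?mulr0.
rewrite CE // [transp' X i i]mxE -!mulrA -scal_central [scal _ * (scal _ * _)]mulrA -scalM.
by rewrite Cq_conj_diag scal1 mul1r.
Qed.

Let p1 : U -> Ut := qpi (@Ut_rel K q ct n f).
Let p1H : is_alg_hom p1 := qpi_hom _.
Let p0 : F -> Ut := p1 \o qpi (@U_rel K N R).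
Let p0H : is_alg_hom p0 := alg_hom_comp p1H (qpi_hom _).
Let p0rel x y : U_rel R x y -> p0 x = p0 y.
Proof. by move=> r; rewrite /p0 /= (qpi_rel r). Qed.
Let p1rel x y : Ut_rel x y -> p1 x = p1 y := @qpi_rel _ _ _ x y.

Local Notation l pm i j := (genUt (Ell pm i j 0)).

Let l_tri pm (i j : 'I_N) : (if pm then i < j else j < i)%N -> l pm i j = 0.
Proof.
move=> ij; change (p0 (fgen K (Ell pm i j 0)) = 0).
rewrite -(alg_hom0 p0H); apply: p0rel.
by case: pm ij => ij; [apply: U_tri_plus | apply: U_tri_minus].
Qed.

(** This is a diagonal entry of the constant term of the relation with [Cq]. By triangularity [l_is]
    vanishes for [s] on one side of [i], and [l_i's'] for [s] on the other, since reversal inverts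
    the order. *)
Lemma Ell_rev pm i : l pm i i * l pm (rev_ord i) (rev_ord i) = 1.
Proof.
pose X : 'M[Ut]_N := \matrix_(i, j) l pm i j.
have XE : map_mx p1 (@Lmat K q ct n f pm 0) = X by apply/matrixP => r s; rewrite !mxE.
have XT : map_mx p1 (transp' (@Lmat K q ct n f pm 0)) = transp' X.
  by apply/matrixP => r s; rewrite -XE !mxE.
have lE r s : X r s = l pm r s by rewrite mxE.
rewrite -!lE -LCLC_entry; last first.
  move=> s; rewrite -val_eqE /= neq_ltn !lE => si.
  have iN := ltn_ord i; have sN := ltn_ord s.
  case: (boolP (if pm then i < s else s < i)%N) => [/l_tri|is_]; first by left.
  by right; apply: l_tri => /=; move: is_; case: (pm); lia.
rewrite -XT -XE -!(alg_hom_scal_mx p1H) -!(alg_hom_mulmx p1H) mxE.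
have <- : @LCLC K q ct n f pm 0 =
    @Lmat K q ct n f pm 0 *m scal_mx U (Cq q ct n) *m transp' (@Lmat K q ct n f pm 0)
      *m scal_mx U (invmx (Cq q ct n)).
  rewrite /LCLC big_ord1 subnn; set z := scal _.
  have -> : z = 1 by rewrite /z oppr0 if_same expr0z scal1.
  by rewrite scale1r.
rewrite (p1rel (@Ut_unit K q ct n f pm 0 i i)) !eqxx; exact: (alg_hom1 p1H).
Qed.

Lemma genUt_Gam_inv b : genUt (Gam b true) * genUt (Gam b false) = 1.
Proof.
rewrite -[LHS](alg_homM p0H) (p0rel (U_gam_inv R b)); exact: alg_hom1 p0H.
Qed.

Lemma genUt_Gam_comm b s x : x * genUt (Gam b s) = genUt (Gam b s) * x.
Proof.
by have [y ->] := qpi_surj x; have [z ->] := qpi_surj y; apply: (Gam_comm p0H p0rel).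
Qed.

Lemma genUt_Ell_invr pm i : l pm i i * genUt (EllInv pm i) = 1.
Proof. exact: (Ell_invr p0H p0rel). Qed.

Lemma genUt_Ell_invl pm i : genUt (EllInv pm i) * l pm i i = 1.
Proof. exact: (Ell_invl p0H p0rel). Qed.

Definition zetaU (i : 'I_N) : Ut := l true i i * l false i i.

Lemma zetaU_swap i : l false i i * l true i i = zetaU i.
Proof. exact/esym/(diag_comm q0 f0 p0H p0rel). Qed.

Lemma zetaU_central i : central (zetaU i).
Proof.
move=> x; have [y ->] := qpi_surj x; have [z ->] := qpi_surj y.
exact/esym/(zeta_comm q0 f0 p0H p0rel i z).
Qed.

(** With the second factor in swapped order, the inner pair [l^-_ii l^-_i'i'] cancels first, then
    the outer pair. *)
Lemma zetaU_rev i : zetaU i * zetaU (rev_ord i) = 1.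
Proof.
rewrite -(zetaU_swap (rev_ord i)) /zetaU -mulrA [l false i i * _]mulrA Ell_rev mul1r.
exact: Ell_rev.
Qed.

Lemma zetaU_mid i : ct = TypeB -> mid i -> zetaU i = 1.
Proof.
move=> cB mi; have lE pm : l pm i i = 1.
  by rewrite -[LHS]/(p1 _) (p1rel (@Ut_mid K q ct n f pm i cB mi)); apply: (alg_hom1 p1H).
by rewrite /zetaU !lE mulr1.
Qed.

Lemma algUt_hom_unique (C : pzAlgType K) (g h : Ut -> C) :
  is_alg_hom g -> is_alg_hom h -> (forall x, g (genUt x) = h (genUt x)) -> g =1 h.
Proof.
move=> gH hH gh; apply: quot_hom_unique; apply: quot_free_hom_unique gh.
  exact: alg_hom_comp gH p1H.
exact: alg_hom_comp hH p1H.
Qed.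
End Unitarity.

Lemma centralM (R : pzRingType) (a b : R) : central a -> central b -> central (a * b).
Proof. by move=> ac bc x; rewrite -mulrA bc mulrA ac mulrA. Qed.

Lemma centralX (R : pzRingType) (a : R) k : central a -> central (a ^+ k).
Proof.
move=> ac; elim: k => [|k IHk]; first by move=> x; rewrite mul1r mulr1.
by rewrite exprS; apply: centralM.
Qed.

(** * Injectivity *)

Section LaurentHom.
Variables (K : fieldType) (m : nat).
Local Notation L := (laurent K m).

Lemma lmonom_only (mu : 'rV[int]_m) i : (forall j, j != i -> mu ord0 j = 0) ->
  lmonom K mu = lvar K i (0 <= mu ord0 i) ^+ `|mu ord0 i|%N.
Proof. by move=> mu0; rewrite /lmonom (big_only1 i) // => j /mu0 ->. Qed.

Lemma lmonom_delta i : lmonom K (delta_mx ord0 i) = lvar K i true :> L.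
Proof.
rewrite (@lmonom_only _ i) => [|j ji]; first by rewrite mxE !eqxx.
by rewrite mxE (negPf ji) andbF.
Qed.

Lemma lmonomN_delta i : lmonom K (- delta_mx ord0 i) = lvar K i false :> L.
Proof.
rewrite (@lmonom_only _ i) => [|j ji]; first by rewrite !mxE !eqxx.
by rewrite !mxE (negPf ji) andbF oppr0.
Qed.

Lemma lmonomN (mu : 'rV[int]_m) : lmonom K mu * lmonom K (- mu) = 1 :> L.
Proof. by rewrite -lmonomD subrr lmonom0. Qed.

Lemma laurent_hom_exists (C : pzAlgType K) (t t' : 'I_m -> C) :
  (forall i, central (t i)) -> (forall i, central (t' i)) ->
  (forall i, t i * t' i = 1) ->
  exists chi : L -> C, [/\ is_alg_hom chi, forall a, central (chi a),
    forall i, chi (lvar K i true) = t i & forall i, chi (lvar K i false) = t' i].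
Proof.
move=> tc tc' tt'; pose u (x : 'I_m * bool) := if x.2 then t x.1 else t' x.1.
have uc x : central (u x) by rewrite /u; case: ifP.
have [g gH gE] := free_hom_exists u.
have [x y r|chi chiH chiE] := quot_hom_exists (rel := @laurent_rel K m) gH.
  case: r => [a b|i].
    by rewrite [LHS](alg_homM gH) [RHS](alg_homM gH) !gE; exact: uc.
  by rewrite (alg_homM gH) (alg_hom1 gH) !gE; exact: tt'.
exists chi; split=> //.
- move=> a x; apply: (quot_free_comm (g := chi) (c := x) chiH) => y.
  by rewrite chiE gE; exact: uc.
- by move=> i; rewrite /lvar chiE gE.
- by move=> i; rewrite /lvar chiE gE.
Qed.

(** Fourth roots are adjoined throughout, and the power [4 / e i] of a fourth root is an [e i]-th
    root. The inverse variables go to the roots of [c i], as the elements to be matched have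
    negative degrees. *)
Lemma laurent_root_hom (B : pzAlgType K) (e : 'I_m -> nat) (c d : 'I_m -> B) :
  (forall i, e i %| 4)%N -> (forall i, central (c i)) -> (forall i, central (d i)) ->
  (forall i, c i * d i = 1) ->
  exists (A : pzAlgType K) (iota : B -> A) (chi : L -> A),
  [/\ embedding iota, is_alg_hom chi & forall a, central (chi a)] /\
  forall i, chi (lvar K i false) ^+ e i = iota (c i) /\
            chi (lvar K i true) ^+ e i = iota (d i).
Proof.
move=> e4 cc dc cd.
have [A [iota [r [ie rc r4]]]] := fourth_root_family cc; have [iH _ ic] := ie.
have icd i : iota (c i) * iota (d i) = 1 by rewrite -(alg_homM iH) cd (alg_hom1 iH).
(* This is the inverse of [r i], because [r^4 d = c d = 1]. *)
pose r' i := r i ^+ 3 * iota (d i).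
have r'c i : central (r' i) := centralM (centralX 3 (rc i)) (ic _ (dc i)).
have rr' i : r i * r' i = 1 by rewrite mulrA -exprS r4 icd.
have rr'X i k : r i ^+ k * r' i ^+ k = 1.
  by rewrite -exprMn_comm ?rr' ?expr1n //; exact: rc.
(* Indeed [r'^4 = r'^4 c d = r'^4 r^4 d = d]. *)
have r'4 i : r' i ^+ 4 = iota (d i).
  rewrite -[LHS]mulr1 -(icd i) mulrA -(r4 i) -(centralX 4 (rc i)) rr'X.
  exact: mul1r.
have [|||chi [chiH chic chiT chiF]] := @laurent_hom_exists A
  (fun i => r' i ^+ (4 %/ e i)) (fun i => r i ^+ (4 %/ e i)).
- by move=> i; exact: centralX.
- by move=> i; exact: centralX.
- by move=> i; rewrite -(centralX _ (rc i)) rr'X.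
exists A, iota, chi; split=> // i.
by rewrite chiT chiF -!exprM divnK // r4 r'4.
Qed.
End LaurentHom.

Section Main.
Variables (K : fieldType) (q : K) (ct : classical_type) (n : nat) (f : nat -> K).
Local Notation N := (dimN ct n).
Local Notation eps := (@epsilon ct n).
Local Notation Ut := (algUt q ct n f).
Local Notation Ut' := (algUt' q ct n f).
Local Notation L := (laurent K n.+1).
Local Notation genUt := (@genUt K q ct n f).
Local Notation genUt' := (@genUt' K q ct n f).
Local Notation zeta := (@zetaU K q ct n f).
Hypotheses (q0 : q != 0) (f0 : f 0%N = 1).

Let gg : Ut := genUt (Gam false true) * genUt (Gam true true).
Let gg' : Ut := genUt (Gam false false) * genUt (Gam true false).

Let gg_central : central gg.
Proof.
by apply: centralM => x; apply/esym; apply: genUt_Gam_comm.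
Qed.

Let gg'_central : central gg'.
Proof. by apply: centralM => x; apply/esym; apply: genUt_Gam_comm. Qed.

Let ggV : gg * gg' = 1.
Proof.
rewrite /gg /gg' (genUt_Gam_comm true false (genUt (Gam false false))).
rewrite -mulrA [X in _ * X]mulrA genUt_Gam_inv mul1r; exact: genUt_Gam_inv.
Qed.

Lemma weps_delta (k : 'I_n) : weps n k = delta_mx ord0 (lift ord0 k).
Proof. by apply/rowP => j; rewrite !mxE eqxx. Qed.

(** Only [n + 1] roots are chosen. For [i > n] with [i' <= n] the condition follows from
    [zeta_i' = zeta_i^-1], and at the middle index of type B both sides are 1. *)
Lemma root_extension : exists (A : pzAlgType K) (iota : Ut -> A) (chi : L -> A),
  [/\ embedding iota, is_alg_hom chi, forall a, central (chi a),
    chi (lmonom K (- wdelta n)) ^+ 2 = iota gg &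
    forall i, chi (lmonom K (- eps i)) ^+ 4 = iota (zeta i)].
Proof.
have nN : (n <= N)%N by rewrite /dimN; case: ct; lia.
(* Index 0 stands for [delta], where a square root is wanted; the others stand for the
   [epsilon_i]. *)
pose e (j : 'I_n.+1) := if j == ord0 then 2%N else 4.
pose c (j : 'I_n.+1) := if unlift ord0 j is Some k then zeta (widen_ord nN k) else gg.
pose d (j : 'I_n.+1) :=
  if unlift ord0 j is Some k then zeta (rev_ord (widen_ord nN k)) else gg'.
have [|||| A [iota [chi [[ie chiH chic] chi4]]]] := @laurent_root_hom K n.+1 Ut e c d.
- by move=> j; rewrite /e; case: ifP.
- by move=> j; rewrite /c; case: unlift => [k|]; [exact: zetaU_central | exact: gg_central].
- move=> j; rewrite /d; case: unlift => [k|]; [exact: zetaU_central |].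
  exact: gg'_central.
- by move=> j; rewrite /c /d; case: unlift => [k|]; [exact: zetaU_rev | exact: ggV].
have c0 : c ord0 = gg by rewrite /c unlift_none.
have cS k : c (lift ord0 k) = zeta (widen_ord nN k).
  rewrite /c liftK; reflexivity.
have dS k : d (lift ord0 k) = zeta (rev_ord (widen_ord nN k)).
  rewrite /d liftK; reflexivity.
have eS k : e (lift ord0 k) = 4 by rewrite /e eq_sym (negPf (neq_lift _ _)).
have iH := embedding_hom ie.
exists A, iota, chi; split=> //.
- by rewrite lmonomN_delta (chi4 ord0).1 c0.
- move=> i; rewrite /epsilon; case: ltnP => [ltin|lein].
    pose k := Ordinal ltin.
    have -> : i = widen_ord nN k by exact: val_inj.
    rewrite -(cS k) -(chi4 _).1 (eS k) -[X in weps n X]/(val k) (weps_delta k).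
    by rewrite lmonomN_delta.
  case: ltnP => [ltin|lein'].
    pose k := Ordinal ltin.
    have iE : i = rev_ord (widen_ord nN k).
      by apply: rev_ord_inj; rewrite rev_ordK; exact: val_inj.
    rewrite [in RHS]iE.
    rewrite -(dS k) -(chi4 _).2 (eS k) -[X in weps n X]/(val k) (weps_delta k).
    by rewrite opprK lmonom_delta.
  have NE : N = n.*2 \/ N = n.*2.+1 /\ ct = TypeB.
    by rewrite /dimN; case: ct; [right | left | left].
  have [No cB] : N = n.*2.+1 /\ ct = TypeB.
    by case: NE => // NE; move: (ltn_ord i) lein lein' NE => /=; lia.
  rewrite oppr0 lmonom0 (alg_hom1 chiH) expr1n zetaU_mid ?(alg_hom1 iH) //.
  by rewrite /mid /idx; move: (ltn_ord i) No lein lein' => /=; lia.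
Qed.
End Main.

(** * Construction of [eta] and of the untwisting homomorphism *)

Section Eta.
Variables (K : fieldType) (q : K) (ct : classical_type) (n : nat) (f : nat -> K).
Local Notation N := (dimN ct n).
Local Notation eps := (@epsilon ct n).
Local Notation Ut := (algUt q ct n f).
Local Notation Ut' := (algUt' q ct n f).
Local Notation L := (laurent K n.+1).
Local Notation genUt := (@genUt K q ct n f).
Local Notation genUt' := (@genUt' K q ct n f).
Local Notation zeta := (@zetaU K q ct n f).

(** The homomorphism is the twist of the map sending [x] to its image tensor 1, by the monomials 1
    tensor [L_mu]. *)
Lemma eta_exists : exists2 eta : Ut -> tensor Ut' L, is_alg_hom eta &
  forall x, eta (genUt x) = tens (genUt' x) (lmonom K (gen_deg x)).
Proof.
pose Z mu : tensor Ut' L := tens 1 (lmonom K mu).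
have rH := tensr_hom Ut' L.
have Z0 : Z 0 = 1 by rewrite /Z lmonom0; exact: alg_hom1 rH.
have ZD mu nu : Z (mu + nu) = Z mu * Z nu by rewrite /Z lmonomD; exact: alg_homM rH _ _.
pose h := (fun x => tens x 1 : tensor Ut' L) \o qpi (@Ut'_rel K q ct n f).
have hH : is_alg_hom h := alg_hom_comp (tensl_hom Ut' L) (qpi_hom _).
have [|eta eH etaE] := twist_hom Z0 ZD hH.
  by move=> mu x; exact/esym/tens_comm.
exists eta => [|x]; first exact: eH.
rewrite tens_split; exact: etaE.
Qed.

Hypotheses (q0 : q != 0) (f0 : f 0%N = 1).

(** The relation [gamma'^(1/2) = gamma^(-1/2)] after untwisting:
    [ai v = ai v^2 u = ai a a' u = a' u]. *)
Lemma untwist_Gam (A : pzRingType) (a ai a' u v : A) : central u ->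
  ai * a = 1 -> v * u = 1 -> v ^+ 2 = a * a' -> a' * u = ai * v.
Proof.
by move=> uc aia vu v2; rewrite -[v]mulr1 -vu [v * (v * u)]mulrA -expr2 v2 !mulrA aia mul1r.
Qed.

(** The relation between [(l_ii[0])^-1] and the opposite-sign [l_ii[0]] after untwisting:
    [e v^2 = e v^4 u^2 = e l l' u^2 = l' u^2]. *)
Lemma untwist_Ell (A : pzRingType) (l l' e u v : A) : central u ->
  e * l = 1 -> v * u = 1 -> v ^+ 4 = l * l' -> e * v ^+ 2 = l' * u ^+ 2.
Proof.
move=> uc el vu v4; have vu2 : v ^+ 2 * u ^+ 2 = 1.
  by rewrite -exprMn_comm ?vu ?expr1n //; exact/esym/uc.
by rewrite -[v ^+ 2]mulr1 -vu2 [v ^+ 2 * (_ * _)]mulrA -exprD v4 !mulrA el mul1r.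
Qed.

(** Twisting [iota] by the inverse monomials brings every element to degree 0, and the two extra
    relations of [algUt'] then hold by the choice of the roots. *)
Lemma untwist_exists (A : pzAlgType K) (iota : Ut -> A) (chi : L -> A) :
  is_alg_hom iota -> is_alg_hom chi -> (forall a, central (chi a)) ->
  chi (lmonom K (- wdelta n)) ^+ 2 =
    iota (genUt (Gam false true) * genUt (Gam true true)) ->
  (forall i, chi (lmonom K (- eps i)) ^+ 4 = iota (zeta i)) ->
  exists2 psi : Ut' -> A, is_alg_hom psi &
    forall x, psi (genUt' x) = iota (genUt x) * chi (lmonom K (- gen_deg x)).
Proof.
move=> iH chiH chic chi2 chi4.
(* [Z] is known only through [ZE], which keeps it from being unfolded. *)
have [Z ZE] : exists Z : 'rV[int]_n.+1 -> A, forall mu, Z mu = chi (lmonom K (- mu)).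
  by eexists.
have Zc mu : central (Z mu) by rewrite ZE; exact: chic.
have Z0 : Z 0 = 1 by rewrite ZE oppr0 lmonom0; exact: alg_hom1 chiH.
have ZD mu nu : Z (mu + nu) = Z mu * Z nu.
  by rewrite !ZE opprD lmonomD; exact: alg_homM chiH _ _.
have ZN mu : Z mu * Z (- mu) = 1 by rewrite -ZD subrr.
have ZX mu : Z (mu + mu) = Z mu ^+ 2 := ZD mu mu.
have Zl i : Z (- eps i - eps i - wdelta n *+ (2 * 0)) = Z (- eps i) ^+ 2.
  by rewrite muln0 mulr0n subr0; exact: ZD.
have {}chi2 : Z (wdelta n) ^+ 2 = _ := etrans (congr1 (fun z => z ^+ 2) (ZE _)) chi2.
have {}chi4 i : Z (eps i) ^+ 4 = _ := etrans (congr1 (fun z => z ^+ 4) (ZE _)) (chi4 i).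
have [|h hH hE] := twist_hom Z0 ZD iH; first by move=> mu x; exact: Zc.
have [x y|psi psiH psiE] := quot_hom_exists (rel := @Ut'_rel K q ct n f) hH; last first.
  by exists psi => [|x]; [exact: psiH | rewrite -ZE -hE; exact: psiE].
case=> [|pm i]; rewrite !hE /gen_deg.
- apply: (@untwist_Gam A (iota (genUt (Gam false true)))).
  + exact: Zc.
  + rewrite -(alg_homM iH) -genUt_Gam_comm genUt_Gam_inv; exact: alg_hom1 iH.
  + exact: ZN.
  + rewrite -[RHS](alg_homM iH); exact: chi2.
- rewrite ZX Zl.
  apply: (@untwist_Ell A (iota (genUt (Ell pm i i 0)))).
  + exact: Zc.
  + rewrite -(alg_homM iH) genUt_Ell_invl; exact: alg_hom1 iH.
  + exact: ZN.
  + rewrite -[RHS](alg_homM iH) [LHS]chi4.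
    (* For the sign - the two factors of [zeta i] come in the opposite order. *)
    case: pm; first reflexivity.
    rewrite -(zetaU_swap q0 f0 i); reflexivity.
Qed.
End Eta.

(** * Uniqueness and injectivity of [eta] *)

Lemma left_inverse_unique (R : pzRingType) (x y z : R) : x * y = 1 -> z * x = 1 -> y = z.
Proof. by move=> xy zx; rewrite -[y]mul1r -zx -mulrA xy mulr1. Qed.

Theorem proposition8p18 (K : closedFieldType) (q : K) (ct : classical_type)
    (n : nat) (f : nat -> K) :
  transcendental q -> rank_ok ct n ->
  normalizing_series (parxi q ct n) (parv q ct) f ->
  exists2 eta : algUt q ct n f -> tensor (algUt' q ct n f) (laurent K n.+1),
    unique (fun eta => [/\ is_alg_hom eta,
      eta (genUt q f (Gam false true)) =
        tens (genUt' q f (Gam false true)) (lmonom K (- wdelta n)),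
      eta (genUt q f (Gam true true)) =
        tens (genUt' q f (Gam false false)) (lmonom K (- wdelta n))
      & forall (pm : bool) (i j : 'I_(dimN ct n)) (m : nat),
          eta (genUt q f (Ell pm i j m)) =
          tens (genUt' q f (Ell pm i j m))
            (lmonom K (- epsilon i - epsilon j - wdelta n *+ (2 * m)))]) eta
    & injective eta.
Proof.
move=> qT _ [f0 _].
have q0 : q != 0.
  by have := qT (polyX _); rewrite map_polyX rootX; apply; rewrite polyX_eq0.
have [eta etaH etaE] := eta_exists q ct n f.
have gam' : genUt' q f (Gam true true) = genUt' q f (Gam false false) :> algUt' q ct n f.
  exact/qpi_rel/Ut'_gam.
exists eta.
- split.
    split; [exact: etaH | exact: etaE | | by move=> pm i j m; exact: etaE].
    by rewrite -gam'; exact: etaE.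
  move=> eta' [eta'H e1 e2 e3]; apply/funext.
  apply: (algUt_hom_unique etaH eta'H) => x.
  (* The values on the inverse generators are not prescribed, but are forced by those on the
     generators they invert. *)
  have uniq_inv a b : a * b = 1 -> b * a = 1 -> eta a = eta' a -> eta b = eta' b.
    move=> ab ba eab; apply: (@left_inverse_unique _ (eta a)).
      by rewrite -(alg_homM etaH) ab; exact: alg_hom1 etaH.
    by rewrite eab -(alg_homM eta'H) ba; exact: alg_hom1 eta'H.
  have eGam b : eta (genUt q f (Gam b true)) = eta' (genUt q f (Gam b true)).
    case: b; last by rewrite e1; exact: etaE.
    by rewrite e2 -gam'; exact: etaE.
  have eEll pm i j m : eta (genUt q f (Ell pm i j m)) = eta' (genUt q f (Ell pm i j m)).
    by rewrite e3; exact: etaE.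
  case: x => [b [|]|pm i j m|pm i]; [exact: eGam | | exact: eEll | ].
    apply: (uniq_inv _ _ _ _ (eGam b)); first exact: genUt_Gam_inv.
    by rewrite genUt_Gam_comm genUt_Gam_inv.
  apply: (uniq_inv _ _ _ _ (eEll pm i i 0%N)).
    exact: genUt_Ell_invr.
  exact: genUt_Ell_invl.
- have [A [iota [chi [[iH iinj _] chiH chic chi2 chi4]]]] := root_extension ct n q0 f0.
  have [psi psiH psiE] := untwist_exists q0 f0 iH chiH chic chi2 chi4.
  have [th thH thE] := tens_hom_exists psiH chiH (fun a b => esym (chic b (psi a))).
  (* On each generator the [L_mu] from [eta] cancels the [L_(-mu)] from [psi], leaving the injective
     [iota]. *)
  have thetaK x : th (eta x) = iota x.
    apply: (algUt_hom_unique (g := th \o eta) (alg_hom_comp thH etaH) iH) => {}x /=.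
    rewrite etaE thE psiE -mulrA -(alg_homM chiH) laurent_commutative lmonomN.
    by rewrite (alg_hom1 chiH) mulr1.
  by move=> x y xy; apply: iinj; rewrite -!thetaK xy.
Qed.
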